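(* Let $k$ be a commutative field, let $\mathcal{A}$ be an essentially small additive category which is $k$-trivial, and let $A$ be an object of $\mathbf{Rep}(\mathcal{A})$. The following assertions are equivalent: 1. $A$ has finite length in $\mathbf{Rep}(\mathcal{A})$; 2. $k[A]$ has finite length in $\mathcal{F}(\mathcal{A};k)$. Moreover, when they hold, the composition factors of $k[A]$ are exactly the functors $\mathrm{Q}(B,M)$, where $B$ is a subquotient of $A$ and $M$ is a simple $k[\mathrm{Aut}(B)]$-module.
   Context: $\mathbf{Rep}(\mathcal{A})$ is the abelian category of additive functors $\mathcal{A}\to\mathbf{Ab}$; $\mathcal{F}(\mathcal{A};k)$ is the abelian category of all (not necessarily additive) functors from $\mathcal{A}$ to $k$-vector spaces. Exactness is pointwise in both. For $A\in\mathbf{Rep}(\mathcal{A})$, $k[A]$ is the functor $x\mapsto k[A(x)]$ ($k$-linearization of sets). $\mathcal{A}$ is $k$-trivial if for all objects $x,y$ the abelian group $\mathcal{A}(x,y)$ is finite of order invertible in $k$. For $B\in\mathbf{Rep}(\mathcal{A})$, $\mathrm{Q}_B$ is the cokernel of $\bigoplus_{C\subsetneq B}k[C]\to k[B]$ (induced by inclusions of proper subfunctors) and $\mathrm{Q}^B$ is the kernel of $k[B]\to\prod_{0\neq C\subset B}k[B/C]$ (induced by projections); both carry canonical actions of $\mathrm{Aut}(B)$. For a $k[\mathrm{Aut}(B)]$-module $M$, $\mathrm{Q}(B,M)$ is the image of the composite $$M\underset{k[\mathrm{Aut}(B)]}{\otimes}\mathrm{Q}^B\to M\underset{k[\mathrm{Aut}(B)]}{\otimes}k[B]\to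 M\underset{k[\mathrm{Aut}(B)]}{\otimes}\mathrm{Q}_B$$ induced by $\mathrm{Q}^B\hookrightarrow k[B]\twoheadrightarrow\mathrm{Q}_B$, where $M\otimes_{k[G]}X$ means the coinvariants $(M\otimes_k X)_G$ for the diagonal action. *)

(* Defs.v *)
From HB Require Import structures.
From mathcomp Require Import all_boot all_order all_algebra.
From mathcomp Require Import generic_quotient ring_quotient boolp freeg.

Set Implicit Arguments.
Unset Strict Implicit.
Unset Printing Implicit Defensive.

Import GRing.Theory.
Local Open Scope ring_scope.

Section MkSubmod.
Context (R : pzRingType) (V : lmodType R) (P : V -> Prop).
Hypotheses (P0 : P 0) (PD : forall u v, P u -> P v -> P (u + v)).
Hypothesis (PZ : forall a v, P v -> P (a *: v)).

Let p : pred V := fun v => `[< P v >].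

Let p_closed : submod_closed p.
Proof.
split; first exact/asboolP.
by move=> a u v /asboolP Pu /asboolP Pv; apply/asboolP/PD/Pv/PZ.
Qed.

Definition mk_submod : submodClosed V :=
  HB.pack_for (submodClosed V) p (GRing.isSubmodClosed.Build R V p p_closed).

Lemma mk_submodP v : reflect (P v) (v \in mk_submod).
Proof. exact: asboolP. Qed.
End MkSubmod.

Section SubModule.
Context (R : pzRingType) (V : lmodType R) (S : submodClosed V).

Record submodule := SubModule { smval : V; _ : smval \in S }.

HB.instance Definition _ := [isSub for smval].
HB.instance Definition _ := [Choice of submodule by <:].
HB.instance Definition _ := [SubChoice_isSubLmodule of submodule by <:].
End SubModule.

Section QuoModule.
Context (R : pzRingType) (V : lmodType R) (S : submodClosed V).

Let zS : zmodClosed V :=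
  HB.pack_for (zmodClosed V) (GRing.SubmodClosed.sort S)
    (GRing.isZmodClosed.Build V (GRing.SubmodClosed.sort S)
       (GRing.subsemimod_closedB (GRing.subsemimodClosedP S))).

Definition quomod : Type := Quotient.quot zS.
HB.instance Definition _ := GRing.Zmodule.on quomod.

Definition qpi (v : V) : quomod := (\pi_(Quotient.quot zS) v)%qT.
Definition qrepr (q : quomod) : V := repr (q : Quotient.quot zS).

Lemma qreprK : cancel qrepr qpi.
Proof. by move=> q; rewrite /qpi /qrepr reprK. Qed.

Lemma qpiP u v : reflect (qpi u = qpi v) (u - v \in S).
Proof.
have -> : (u - v \in S) = (u - v \in zS) by [].
by rewrite Quotient.idealrBE; apply: (iffP eqP).
Qed.

Fact qpi_zmod : zmod_morphism qpi.
Proof. by move=> u v; rewrite /qpi raddfB. Qed.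
HB.instance Definition _ := GRing.isZmodMorphism.Build V quomod qpi qpi_zmod.

Lemma qpi_eq0P v : reflect (qpi v = 0) (v \in S).
Proof. by rewrite -[X in reflect _ (X \in S)]subr0 -(raddf0 qpi); apply: qpiP. Qed.

Definition qscale (a : R) (q : quomod) : quomod := qpi (a *: qrepr q).

Lemma qpi_scale a v : qpi (a *: v) = qscale a (qpi v).
Proof.
apply/qpiP; rewrite -scalerBr; apply: rpredZ.
by apply/qpiP; rewrite qreprK.
Qed.

Fact qscaleA a b q : qscale a (qscale b q) = qscale (a * b) q.
Proof. by rewrite -[q]qreprK -!qpi_scale scalerA. Qed.
Fact qscale1 : left_id 1 qscale.
Proof. by move=> q; rewrite -[q in LHS]qreprK -qpi_scale scale1r qreprK. Qed.
Fact qscaleDr : right_distributive qscale +%R.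
Proof.
move=> a p q; rewrite -[p]qreprK -[q]qreprK -raddfD -!qpi_scale.
by rewrite scalerDr raddfD.
Qed.
Fact qscaleDl q : {morph qscale^~ q : a b / a + b}.
Proof. by move=> a b; rewrite -[q]qreprK -!qpi_scale scalerDl raddfD. Qed.

HB.instance Definition _ :=
  GRing.Zmodule_isLmodule.Build R quomod qscaleA qscale1 qscaleDr qscaleDl.

Fact qpi_scalable : scalable qpi. Proof. by move=> a v; apply: qpi_scale. Qed.
HB.instance Definition _ := GRing.isScalable.Build R V quomod *:%R qpi qpi_scalable.
End QuoModule.


Section InducedMaps.
Context (R : pzRingType) (V W : lmodType R) (f : {linear V -> W}).
Context (S : submodClosed V) (T : submodClosed W).
Hypothesis fST : forall v, v \in S -> f v \in T.

Definition submod_map (u : submodule S) : submodule T :=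
  SubModule (fST (valP u)).

Fact submod_map_linear : linear submod_map.
Proof. by move=> a u v; apply: val_inj; rewrite /= linearP. Qed.
HB.instance Definition _ :=
  GRing.isLinear.Build R (submodule S) (submodule T) *:%R submod_map
    submod_map_linear.

(* The unused proof makes the linear structure below inferable. *)
Definition quomod_map (_ : forall v, v \in S -> f v \in T) (q : quomod S) :
  quomod T := qpi T (f (qrepr q)).

Lemma quomod_mapE v : quomod_map fST (qpi S v) = qpi T (f v).
Proof.
by apply/qpiP; rewrite -raddfB; apply/fST/qpiP; rewrite qreprK.
Qed.

Fact quomod_map_linear : linear (quomod_map fST).
Proof.
move=> a p q; rewrite -[p]qreprK -[q]qreprK -linearP !quomod_mapE.
by rewrite !linearP.
Qed.
HB.instance Definition _ :=
  GRing.isLinear.Build R (quomod S) (quomod T) *:%R (quomod_map fST)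
    quomod_map_linear.
End InducedMaps.
Arguments submod_map {R V W} f {S T} fST u.
Arguments quomod_map {R V W} f {S T} _ q.

Section SubModuleVal.
Context (R : pzRingType) (V : lmodType R) (S : submodClosed V).
Fact smval_linear : linear (@smval R V S). Proof. by []. Qed.
HB.instance Definition _ :=
  GRing.isLinear.Build R (submodule S) V *:%R (@smval R V S) smval_linear.
End SubModuleVal.

Section Span.
Context (R : pzRingType) (V : lmodType R) (X : V -> Prop).

Let in_span (v : V) : Prop :=
  forall S : submodClosed V, (forall u, X u -> u \in S) -> v \in S.

Let in_span0 : in_span 0. Proof. by move=> S _; apply: rpred0. Qed.
Let in_spanD u v : in_span u -> in_span v -> in_span (u + v).
Proof. by move=> hu hv S XS; apply: rpredD; [apply: hu | apply: hv]. Qed.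
Let in_spanZ a v : in_span v -> in_span (a *: v).
Proof. by move=> hv S XS; apply/rpredZ/hv. Qed.

Definition span_of : submodClosed V := mk_submod in_span0 in_spanD in_spanZ.

Lemma span_ofP (v : V) :
  reflect (forall S : submodClosed V, (forall u, X u -> u \in S) -> v \in S)
          (v \in span_of).
Proof. exact: mk_submodP. Qed.

Lemma sub_span_of v : X v -> v \in span_of.
Proof. by move=> Xv; apply/span_ofP => S; apply. Qed.
End Span.

Section SpanMap.
Context (R : pzRingType) (V W : lmodType R) (f : {linear V -> W}).

Section Preimage.
Context (S : submodClosed W).
Let P (v : V) : Prop := f v \in S.
Let P0 : P 0. Proof. by rewrite /P raddf0 rpred0. Qed.
Let PD u v : P u -> P v -> P (u + v).
Proof. by move=> ? ?; rewrite /P raddfD rpredD. Qed.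
Let PZ a v : P v -> P (a *: v).
Proof. by move=> ?; rewrite /P linearZ /= rpredZ. Qed.
Definition submod_preim : submodClosed V := mk_submod P0 PD PZ.
Lemma submod_preimE v : (v \in submod_preim) = (f v \in S).
Proof. by apply/mk_submodP/idP. Qed.
End Preimage.

Section Image.
Let P (w : W) : Prop := exists v, w = f v.
Let P0 : P 0. Proof. by exists 0; rewrite raddf0. Qed.
Let PD u v : P u -> P v -> P (u + v).
Proof. by move=> [a ->] [b ->]; exists (a + b); rewrite raddfD. Qed.
Let PZ a v : P v -> P (a *: v).
Proof. by move=> [b ->]; exists (a *: b); rewrite linearZ. Qed.
Definition submod_im : submodClosed W := mk_submod P0 PD PZ.
Lemma submod_imP w : reflect (exists v, w = f v) (w \in submod_im).
Proof. exact: mk_submodP. Qed.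
End Image.

Lemma span_of_map (X : V -> Prop) (Y : W -> Prop) :
  (forall v, X v -> Y (f v)) ->
  forall v, v \in span_of X -> f v \in span_of Y.
Proof.
move=> XY v /span_ofP/(_ (submod_preim (span_of Y))); rewrite submod_preimE.
by apply=> u Xu; rewrite submod_preimE; apply/sub_span_of/XY.
Qed.
End SpanMap.

Section FreeLift.
Context (k : nzRingType) (X : choiceType) (V : lmodType k) (f : X -> V).

Lemma fgliftU x : fglift f (<< x >> : {freeg X / k}) = f x.
Proof. by rewrite liftU scale1r. Qed.

Fact fglift_zmod : zmod_morphism (fglift f : {freeg X / k} -> V).
Proof. exact: lift_is_additive. Qed.
HB.instance Definition _ :=
  GRing.isZmodMorphism.Build {freeg X / k} V (fglift f) fglift_zmod.

Fact fglift_scalable : scalable (fglift f : {freeg X / k} -> V).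
Proof.
move=> a D; rewrite -{2}[D]freeg_sumE {1}/GRing.scale /= /fgscale !raddf_sum.
by apply: eq_bigr => x _; rewrite /= !liftU scalerA.
Qed.
HB.instance Definition _ :=
  GRing.isScalable.Build k {freeg X / k} V *:%R (fglift f) fglift_scalable.
End FreeLift.

Lemma freeg_ext (k : nzRingType) (X : choiceType) (V : lmodType k)
    (f g : {linear {freeg X / k} -> V}) :
  (forall x, f << x >> = g << x >>) -> f =1 g.
Proof.
move=> fg D; rewrite -[D]freeg_sumE !raddf_sum; apply: eq_bigr => x _.
suff -> : << coeff x D *g x >> = coeff x D *: << x >> :> {freeg X / k}.
  by rewrite /= !linearZ_LR /= fg.
by apply/eqP/freeg_eqP=> y; rewrite coeffZ !coeffU mul1r.
Qed.

Definition free_map (k : nzRingType) (X Y : choiceType) (f : X -> Y) :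
    {freeg X / k} -> {freeg Y / k} :=
  fglift (fun x => << f x >> : {freeg Y / k}).
HB.instance Definition _ k X Y f := GRing.Linear.on (@free_map k X Y f).

Arguments free_map k {X Y} f D : simpl never.

Lemma free_mapU (k : nzRingType) (X Y : choiceType) (f : X -> Y) x :
  free_map k f << x >> = << f x >>.
Proof. exact: fgliftU. Qed.

Section Tensor.
Context (k : comNzRingType).

Section TensorModule.
Context (M V : lmodType k).

Let base : lmodType k := {freeg (M * V)%type / k}.
Let gen (m : M) (v : V) : base := << (m, v) >>.

Inductive bilinear_relator : base -> Prop :=
| RelDl m m' v : bilinear_relator (gen (m + m') v - (gen m v + gen m' v))
| RelDr m v v' : bilinear_relator (gen m (v + v') - (gen m v + gen m v'))
| RelZl a m v : bilinear_relator (gen (a *: m) v - a *: gen m v)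
| RelZr a m v : bilinear_relator (gen m (a *: v) - a *: gen m v).

Definition tensor : lmodType k := quomod (span_of bilinear_relator).

Definition tens (m : M) (v : V) : tensor :=
  qpi (span_of bilinear_relator) (gen m v).

Lemma tensDl m m' v : tens (m + m') v = tens m v + tens m' v.
Proof. by rewrite -raddfD; apply/qpiP/sub_span_of/RelDl. Qed.
Lemma tensDr m v v' : tens m (v + v') = tens m v + tens m v'.
Proof. by rewrite -raddfD; apply/qpiP/sub_span_of/RelDr. Qed.
Lemma tensZl a m v : tens (a *: m) v = a *: tens m v.
Proof. by rewrite -linearZ; apply/qpiP/sub_span_of/RelZl. Qed.
Lemma tensZr a m v : tens m (a *: v) = a *: tens m v.
Proof. by rewrite -linearZ; apply/qpiP/sub_span_of/RelZr. Qed.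

Lemma tensor_ext (W : lmodType k) (f g : {linear tensor -> W}) :
  (forall m v, f (tens m v) = g (tens m v)) -> f =1 g.
Proof.
move=> fg t; rewrite -[t]qreprK; move: (qrepr t) => D.
pose pi := qpi (span_of bilinear_relator).
by apply: (@freeg_ext _ _ _ (f \o pi) (g \o pi)) => -[m v]; apply: fg.
Qed.
End TensorModule.

Section TensorMap.
Context (M M' V V' : lmodType k).
Context (f : {linear M -> M'}) (g : {linear V -> V'}).

Let pre : {linear {freeg (M * V)%type / k} -> {freeg (M' * V')%type / k}} :=
  free_map k (fun u => (f u.1, g u.2)).

Let pre_rel D : D \in span_of (@bilinear_relator M V) ->
  pre D \in span_of (@bilinear_relator M' V').
Proof.
have E m v : pre << (m, v) >> = << (f m, g v) >> by apply: free_mapU.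
apply: span_of_map => {}D [m m' v|m v v'|a m v|a m v]; rewrite linearB.
- by rewrite (linearD pre) !E (linearD f); apply: RelDl.
- by rewrite (linearD pre) !E (linearD g); apply: RelDr.
- by rewrite (linearZ_LR pre) !E (linearZ_LR f); apply: RelZl.
- by rewrite (linearZ_LR pre) !E (linearZ_LR g); apply: RelZr.
Qed.

Definition tens_map : tensor M V -> tensor M' V' := quomod_map pre pre_rel.
HB.instance Definition _ := GRing.Linear.on tens_map.

Lemma tens_mapE m v : tens_map (tens m v) = tens (f m) (g v).
Proof. by rewrite /tens_map quomod_mapE; congr qpi; apply: free_mapU. Qed.
End TensorMap.
End Tensor.
Arguments tens_map {k M M' V V'} f g t : simpl never.

Record preadditive := Preadditive {
  ob :> Type;
  hom : ob -> ob -> zmodType;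
  idm : forall x, hom x x;
  comp : forall x y z, hom y z -> hom x y -> hom x z;
  comp1m : forall x y (f : hom x y), comp (idm y) f = f;
  compm1 : forall x y (f : hom x y), comp f (idm x) = f;
  compA : forall x y z t (h : hom z t) (g : hom y z) (f : hom x y),
    comp h (comp g f) = comp (comp h g) f;
  compDl : forall x y z (g g' : hom y z) (f : hom x y),
    comp (g + g') f = comp g f + comp g' f;
  compDr : forall x y z (g : hom y z) (f f' : hom x y),
    comp g (f + f') = comp g f + comp g f'
}.

Definition has_zero_object (C : preadditive) : Prop :=
  exists z : C, forall x : C,
    (forall f : hom z x, f = 0) /\ (forall f : hom x z, f = 0).

Definition is_biproduct (C : preadditive) (x y s : C)
    (i1 : hom x s) (i2 : hom y s) (p1 : hom s x) (p2 : hom s y) : Prop :=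
  [/\ comp p1 i1 = idm x, comp p2 i2 = idm y, comp p2 i1 = 0, comp p1 i2 = 0
    & comp i1 p1 + comp i2 p2 = idm s].

Definition has_biproducts (C : preadditive) : Prop :=
  forall x y : C, exists s (i1 : hom x s) (i2 : hom y s)
    (p1 : hom s x) (p2 : hom s y), is_biproduct i1 i2 p1 p2.

Record additive_category := AdditiveCategory {
  addcat :> preadditive;
  addcat_zero : has_zero_object addcat;
  addcat_biproducts : has_biproducts addcat
}.

Definition iso_objects (C : preadditive) (x y : C) : Prop :=
  exists (f : hom x y) (g : hom y x), comp g f = idm x /\ comp f g = idm y.

(* The objects of a category form an arbitrary [Type]. Sets are [choiceType]s,
   like the carriers of all algebraic structures; in particular the Hom-groups
   are always small. *)
Definition essentially_small (C : preadditive) : Prop :=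
  exists (I : choiceType) (s : I -> C), forall x, exists i, iso_objects (s i) x.

Definition k_trivial (k : fieldType) (C : preadditive) : Prop :=
  forall x y : C, exists2 e : seq (hom x y),
    Finite.axiom e & (size e)%:R \is a @GRing.unit k.

Record functor (C : preadditive) (R : pzRingType) := Functor {
  fobj :> C -> lmodType R;
  fmap : forall x y, hom x y -> {linear fobj x -> fobj y};
  fmap1 : forall x v, fmap (idm x) v = v;
  fmapM : forall x y z (g : hom y z) (f : hom x y) v,
    fmap (comp g f) v = fmap g (fmap f v)
}.

(* Ab is taken to be the category of Z-modules, so that Rep(C) is the full
   subcategory of additive functors among the functors to [int]-modules. *)
Record rep (C : preadditive) := Rep {
  rep_functor :> functor C int;
  rep_additive : forall x y (f g : hom x y) v,
    fmap rep_functor (f + g) v = fmap rep_functor f v + fmap rep_functor g v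
}.

Record nattrans (C : preadditive) (R : pzRingType) (F G : functor C R) :=
  NatTrans {
    ntm :> forall x, {linear F x -> G x};
    ntm_nat : forall x y (f : hom x y) v, ntm y (fmap F f v) = fmap G f (ntm x v)
  }.

Notation "F ~> G" := (nattrans F G) (at level 55) : type_scope.

Section FunctorCategory.
Context (C : preadditive) (R : pzRingType).
Implicit Types F G H : functor C R.

Definition nt_id F : F ~> F :=
  @NatTrans C R F F (fun x => idfun) (fun _ _ _ _ => erefl).

Fact nt_comp_nat F G H (b : G ~> H) (a : F ~> G) x y (f : hom x y) v :
  (b y \o a y) (fmap F f v) = fmap H f ((b x \o a x) v).
Proof. by rewrite /= !ntm_nat. Qed.

Definition nt_comp F G H (b : G ~> H) (a : F ~> G) : F ~> H :=
  @NatTrans C R F H (fun x => b x \o a x) (nt_comp_nat b a).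

Definition isomorphic F G : Prop :=
  exists (a : F ~> G) (b : G ~> F),
    (forall x, cancel (a x) (b x)) /\ (forall x, cancel (b x) (a x)).

Record subfunctor F := SubFunctor {
  sub_at :> forall x, submodClosed (F x);
  sub_stable : forall x y (f : hom x y) v,
    v \in sub_at x -> fmap F f v \in sub_at y
}.

Definition sub_le F (P Q : subfunctor F) : Prop :=
  forall x v, v \in P x -> v \in Q x.
Definition sub_zero F (P : subfunctor F) : Prop :=
  forall x v, v \in P x -> v = 0.
Definition sub_full F (P : subfunctor F) : Prop := forall x v, v \in P x.

Section SubQuotient.
Context (F : functor C R) (P : subfunctor F).

Let sobj x : lmodType R := submodule (P x).
Let smap x y (f : hom x y) : {linear sobj x -> sobj y} :=
  submod_map (fmap F f) (@sub_stable F P x y f).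
Let smap1 x v : smap (idm x) v = v.
Proof. by apply: val_inj; rewrite /= fmap1. Qed.
Let smapM x y z (g : hom y z) (f : hom x y) v :
  smap (comp g f) v = smap g (smap f v).
Proof. by apply: val_inj; rewrite /= fmapM. Qed.

Definition sub_functor : functor C R := Functor smap1 smapM.
Definition incl : sub_functor ~> F :=
  @NatTrans C R sub_functor F (fun x => @smval R (F x) (P x))
    (fun _ _ _ _ => erefl).

Let qobj x : lmodType R := quomod (P x).
Let qmap x y (f : hom x y) : {linear qobj x -> qobj y} :=
  quomod_map (fmap F f) (@sub_stable F P x y f).
Let qmap1 x v : qmap (idm x) v = v.
Proof. by rewrite -[v]qreprK /qmap /= quomod_mapE fmap1. Qed.
Let qmapM x y z (g : hom y z) (f : hom x y) v :
  qmap (comp g f) v = qmap g (qmap f v).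
Proof. by rewrite -[v]qreprK /qmap /= !quomod_mapE fmapM. Qed.

Definition quo_functor : functor C R := Functor qmap1 qmapM.
Let proj_nat x y (f : hom x y) v :
  qpi (P y) (fmap F f v) = fmap quo_functor f (qpi (P x) v).
Proof. by rewrite /= quomod_mapE. Qed.
Definition proj : F ~> quo_functor :=
  @NatTrans C R F quo_functor (fun x => qpi (P x)) proj_nat.
End SubQuotient.

Section Induced.
Context (F G : functor C R) (a : F ~> G).

Section Maps.
Context (P : subfunctor F) (Q : subfunctor G).
Hypothesis aPQ : forall x v, v \in P x -> a x v \in Q x.

Let sub_nt_nat x y (f : hom x y) v :
  submod_map (a y) (@aPQ y) (fmap (sub_functor P) f v) =
  fmap (sub_functor Q) f (submod_map (a x) (@aPQ x) v).
Proof. by apply: val_inj; rewrite /= ntm_nat. Qed.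
Definition sub_nt : sub_functor P ~> sub_functor Q :=
  @NatTrans C R (sub_functor P) (sub_functor Q)
    (fun x => submod_map (a x) (@aPQ x)) sub_nt_nat.

Let quo_nt_nat x y (f : hom x y) v :
  quomod_map (a y) (@aPQ y) (fmap (quo_functor P) f v) =
  fmap (quo_functor Q) f (quomod_map (a x) (@aPQ x) v).
Proof. by rewrite -[v]qreprK /= !quomod_mapE ntm_nat. Qed.
Definition quo_nt : quo_functor P ~> quo_functor Q :=
  @NatTrans C R (quo_functor P) (quo_functor Q)
    (fun x => quomod_map (a x) (@aPQ x)) quo_nt_nat.
End Maps.

Let preim_stable (Q : subfunctor G) x y (f : hom x y) v :
  v \in submod_preim (a x) (Q x) -> fmap F f v \in submod_preim (a y) (Q y).
Proof. by rewrite !submod_preimE ntm_nat; apply: sub_stable. Qed.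
Definition sub_preim (Q : subfunctor G) : subfunctor F :=
  SubFunctor (@preim_stable Q).

Let im_stable x y (f : hom x y) v :
  v \in submod_im (a x) -> fmap G f v \in submod_im (a y).
Proof.
by case/submod_imP => u ->; rewrite -ntm_nat; apply/submod_imP; exists (fmap F f u).
Qed.
Definition sub_im : subfunctor G := SubFunctor im_stable.
Definition im_functor : functor C R := sub_functor sub_im.
End Induced.

Section Generated.
Context (F : functor C R) (X : forall x, F x -> Prop).
Hypothesis X_stable : forall x y (f : hom x y) v, X v -> X (fmap F f v).
Definition sub_span : subfunctor F :=
  @SubFunctor F (fun x => span_of (@X x))
    (fun x y f => span_of_map (@X_stable x y f)).
End Generated.

(* [Q / (Q :&: P)]; it is only used for [P <= Q]. *)
Definition subquo F (Q P : subfunctor F) : functor C R :=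
  quo_functor (sub_preim (incl Q) P).

Definition simple_functor F : Prop :=
  (exists x (v : F x), v != 0) /\
  forall P : subfunctor F, sub_zero P \/ sub_full P.

Definition composition_series F (n : nat) (s : nat -> subfunctor F) : Prop :=
  [/\ sub_zero (s 0), sub_full (s n),
      forall i, i < n -> sub_le (s i) (s i.+1)
    & forall i, i < n -> simple_functor (subquo (s i.+1) (s i))]%N.

Definition finite_length F : Prop := exists n s, @composition_series F n s.

Definition composition_factor (S F : functor C R) : Prop :=
  exists n (s : nat -> subfunctor F), composition_series n s /\
    exists2 i, (i < n)%N & isomorphic S (subquo (s i.+1) (s i)).

Definition subquotient (B A : functor C R) : Prop :=
  exists P Q : subfunctor A, sub_le P Q /\ isomorphic B (subquo Q P).
End FunctorCategory.

(* Subfunctors and quotients of additive functors are additive: the subobjects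
   and quotients of [A] in [Rep(C)] are those of the underlying functor. *)
Lemma sub_functor_additive (C : preadditive) (A : rep C) (P : subfunctor A)
    x y (f g : hom x y) v :
  fmap (sub_functor P) (f + g) v =
  fmap (sub_functor P) f v + fmap (sub_functor P) g v.
Proof. by apply: val_inj; rewrite /= rep_additive. Qed.

Lemma quo_functor_additive (C : preadditive) (A : rep C) (P : subfunctor A)
    x y (f g : hom x y) v :
  fmap (quo_functor P) (f + g) v =
  fmap (quo_functor P) f v + fmap (quo_functor P) g v.
Proof. by rewrite -[v]qreprK /= !quomod_mapE rep_additive raddfD. Qed.

Section Linearization.
Context (k : nzRingType) (C : preadditive) (R : pzRingType).
Implicit Types F G H : functor C R.

Let lmap F x y (f : hom x y) : {linear {freeg (F x) / k} -> {freeg (F y) / k}} :=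
  free_map k (fmap F f).
Let lmap1 F x v : lmap F (idm x) v = v.
Proof.
by apply: (freeg_ext (g := idfun)) => u; rewrite /= free_mapU fmap1.
Qed.
Let lmapM F x y z (g : hom y z) (f : hom x y) v :
  lmap F (comp g f) v = lmap F g (lmap F f v).
Proof.
apply: (freeg_ext (g := lmap F g \o lmap F f)) => u.
by rewrite /= !free_mapU fmapM.
Qed.

(* [klin F] is k[F], the functor x |-> k[F(x)]. *)
Definition klin F : functor C k := Functor (@lmap1 F) (@lmapM F).

Let lnt_nat F G (a : F ~> G) x y (f : hom x y) v :
  free_map k (a y) (fmap (klin F) f v) = fmap (klin G) f (free_map k (a x) v).
Proof.
apply: (@freeg_ext _ _ _ (free_map k (a y) \o lmap F f)
                         (lmap G f \o free_map k (a x))) => u.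
by rewrite /= !free_mapU ntm_nat.
Qed.

Definition klin_nt F G (a : F ~> G) : klin F ~> klin G :=
  @NatTrans C k (klin F) (klin G) (fun x => free_map k (a x)) (lnt_nat a).

Lemma klin_nt_ext F G (a b : F ~> G) x :
  a x =1 b x -> klin_nt a x =1 klin_nt b x.
Proof. by move=> ab; apply: freeg_ext => u; rewrite /= !free_mapU ab. Qed.

Lemma klin_nt_id F x v : klin_nt (nt_id F) x v = v.
Proof. by apply: (freeg_ext (g := idfun)) => u; rewrite /= free_mapU. Qed.

Lemma klin_nt_comp F G H (b : G ~> H) (a : F ~> G) x v :
  klin_nt (nt_comp b a) x v = klin_nt b x (klin_nt a x v).
Proof.
apply: (freeg_ext (g := klin_nt b x \o klin_nt a x)) => u.
by rewrite /= !free_mapU.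
Qed.
End Linearization.

(* [Q_lower B] and [Q_upper B] are Q_B and Q^B. *)
Section QFunctors.
Context (k : nzRingType) (C : preadditive) (R : pzRingType) (B : functor C R).

(* The image of the direct sum of the k[C], for C a proper subfunctor of B. *)
Let from_proper x (w : klin k B x) : Prop :=
  exists P : subfunctor B, ~ sub_full P /\
    exists u, w = klin_nt k (incl P) x u.
Let from_proper_stable x y (f : hom x y) w :
  from_proper w -> from_proper (fmap (klin k B) f w).
Proof.
move=> [P [propP [u ->]]]; exists P; split=> //.
by exists (fmap (klin k (sub_functor P)) f u); rewrite ntm_nat.
Qed.
Definition proper_part : subfunctor (klin k B) := sub_span from_proper_stable.

Definition Q_lower : functor C k := quo_functor proper_part.

Section Kernel.
Context (x : C).
Let P (w : klin k B x) : Prop :=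
  forall N : subfunctor B, ~ sub_zero N -> klin_nt k (proj N) x w = 0.
Let P0 : P 0. Proof. by move=> N _; rewrite raddf0. Qed.
Let PD u v : P u -> P v -> P (u + v).
Proof. by move=> Pu Pv N N0; rewrite raddfD /= Pu // Pv // addr0. Qed.
Let PZ a v : P v -> P (a *: v).
Proof. by move=> Pv N N0; rewrite linearZ /= Pv // scaler0. Qed.
Definition common_kernel_at : submodClosed (klin k B x) := mk_submod P0 PD PZ.
Lemma common_kernelP w :
  reflect (forall N : subfunctor B, ~ sub_zero N -> klin_nt k (proj N) x w = 0)
          (w \in common_kernel_at).
Proof. exact: mk_submodP. Qed.
End Kernel.

Let common_kernel_stable x y (f : hom x y) w :
  w \in common_kernel_at x -> fmap (klin k B) f w \in common_kernel_at y.
Proof.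
move/common_kernelP=> wK; apply/common_kernelP => N N0.
by rewrite ntm_nat wK // raddf0.
Qed.
Definition common_kernel : subfunctor (klin k B) :=
  SubFunctor common_kernel_stable.

Definition Q_upper : functor C k := sub_functor common_kernel.
End QFunctors.

Section Automorphisms.
Context (C : preadditive) (R : pzRingType) (B : functor C R).

Record aut := Aut {
  aut_fwd :> B ~> B;
  aut_bwd : B ~> B;
  aut_fwdK : forall x, cancel (aut_fwd x) (aut_bwd x);
  aut_bwdK : forall x, cancel (aut_bwd x) (aut_fwd x)
}.

Definition aut_one : aut :=
  @Aut (nt_id B) (nt_id B) (fun _ _ => erefl) (fun _ _ => erefl).

Let mulK (g h : aut) x :
  cancel (nt_comp g h x) (nt_comp (aut_bwd h) (aut_bwd g) x).
Proof. by move=> v; rewrite /= !aut_fwdK. Qed.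
Let mulVK (g h : aut) x :
  cancel (nt_comp (aut_bwd h) (aut_bwd g) x) (nt_comp g h x).
Proof. by move=> v; rewrite /= !aut_bwdK. Qed.
Definition aut_mul (g h : aut) : aut := Aut (mulK g h) (mulVK g h).

Definition aut_inv (g : aut) : aut := Aut (aut_bwdK g) (aut_fwdK g).
End Automorphisms.

Section AutActions.
Context (k : comNzRingType) (C : preadditive) (R : pzRingType).
Context (B : functor C R).

(* Left k[Aut(B)]-modules, given as k-linear representations of Aut(B). *)
Record aut_module := AutModule {
  am_sort :> lmodType k;
  am_act : aut B -> {linear am_sort -> am_sort};
  am_act1 : forall m, am_act (aut_one B) m = m;
  am_actM : forall g h m, am_act (aut_mul g h) m = am_act g (am_act h m)
}.

Definition simple_module (M : aut_module) : Prop :=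
  (exists m : M, m != 0) /\
  forall S : submodClosed M,
    (forall g m, m \in S -> am_act M g m \in S) ->
    (forall m, m \in S -> m = 0) \/ (forall m, m \in S).

Record aut_functor := AutFunctor {
  af_functor :> functor C k;
  af_act : aut B -> af_functor ~> af_functor;
  af_act1 : forall x v, af_act (aut_one B) x v = v;
  af_actM : forall g h x v, af_act (aut_mul g h) x v = af_act g x (af_act h x v)
}.

Definition klin_aut : aut_functor :=
  @AutFunctor (klin k B) (fun g => klin_nt k g) (@klin_nt_id k C R B)
    (fun g h x => @klin_nt_comp k C R B B B g h x).

Let act_proper (g : aut B) x w :
  w \in proper_part k B x -> klin_nt k g x w \in proper_part k B x.
Proof.
apply: span_of_map => {}w [P [propP [u ->]]].
pose gP := sub_preim (aut_bwd g) P.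
have gPP x' v : v \in P x' -> g x' v \in gP x'.
  by rewrite submod_preimE aut_fwdK.
exists gP; split.
  move=> full; apply: propP => x' v.
  by have := full x' (g x' v); rewrite submod_preimE aut_fwdK.
exists (klin_nt k (sub_nt gPP) x u).
by rewrite -!klin_nt_comp; apply: klin_nt_ext.
Qed.

Definition Q_lower_aut : aut_functor.
Proof.
exists (Q_lower k B) (fun g => quo_nt (act_proper g)) => [x v|g h x v].
  by rewrite -[v]qreprK [LHS]quomod_mapE klin_nt_id.
by rewrite -[v]qreprK /= !quomod_mapE klin_nt_comp.
Defined.

Let act_kernel (g : aut B) x w :
  w \in common_kernel k B x -> klin_nt k g x w \in common_kernel k B x.
Proof.
move/common_kernelP=> wK; apply/common_kernelP => N N0.
pose gN := sub_preim g N.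
have gNN x' v : v \in gN x' -> g x' v \in N x' by rewrite submod_preimE.
have gN0 : ~ sub_zero gN.
  move=> z; apply: N0 => x' v vN.
  have /z : aut_bwd g x' v \in gN x' by rewrite submod_preimE aut_bwdK.
  by move/(congr1 (g x')); rewrite aut_bwdK raddf0.
rewrite -klin_nt_comp.
rewrite (@klin_nt_ext _ _ _ _ _ _ (nt_comp (quo_nt gNN) (proj gN))).
  by rewrite klin_nt_comp (wK gN) // raddf0.
by move=> v; rewrite /= quomod_mapE.
Qed.

Definition Q_upper_aut : aut_functor.
Proof.
exists (Q_upper k B) (fun g => sub_nt (act_kernel g)) => [x v|g h x v].
  by apply: val_inj; rewrite /= klin_nt_id.
by apply: val_inj; rewrite /= klin_nt_comp.
Defined.

Section CoinvariantTensor.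
Context (M : aut_module).

Section TensorFunctor.
Context (F : functor C k).
Let tmap x y (f : hom x y) : {linear tensor M (F x) -> tensor M (F y)} :=
  tens_map idfun (fmap F f).
Let tmap1 x t : @tmap x x (idm x) t = t.
Proof.
by apply: (tensor_ext (g := idfun)) => m v; rewrite /= tens_mapE /= fmap1.
Qed.
Let tmapM x y z (g : hom y z) (f : hom x y) t :
  tmap (comp g f) t = tmap g (tmap f t).
Proof.
apply: (tensor_ext (g := tmap g \o tmap f)) => m v.
by rewrite /= !tens_mapE fmapM.
Qed.
Definition tensor_functor : functor C k := Functor tmap1 tmapM.
End TensorFunctor.

Section TensorNat.
Context (F G : functor C k) (r : {linear M -> M}) (a : F ~> G).
Let tnt_nat x y (f : hom x y) t :
  tens_map r (a y) (fmap (tensor_functor F) f t) =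
  fmap (tensor_functor G) f (tens_map r (a x) t).
Proof.
apply: (@tensor_ext _ _ _ _
  (tens_map r (a y) \o fmap (tensor_functor F) f)
  (fmap (tensor_functor G) f \o tens_map r (a x))) => m v.
by rewrite /= !tens_mapE ntm_nat.
Qed.
Definition tensor_nt : tensor_functor F ~> tensor_functor G :=
  @NatTrans C k (tensor_functor F) (tensor_functor G)
    (fun x => tens_map r (a x)) tnt_nat.
End TensorNat.

Section Coinvariants.
Context (F : aut_functor).
Let diag (g : aut B) := tensor_nt (am_act M g) (af_act F g).
Let moved x (w : tensor_functor F x) : Prop :=
  exists g t, w = diag g x t - t.
Let moved_stable x y (f : hom x y) w :
  moved w -> moved (fmap (tensor_functor F) f w).
Proof.
by move=> [g [t ->]]; exists g, (fmap (tensor_functor F) f t); rewrite ntm_nat raddfB.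
Qed.
Definition moved_part : subfunctor (tensor_functor F) := sub_span moved_stable.

(* The coinvariants of the tensor product of M and F for the diagonal action. *)
Definition coinv_tensor : functor C k := quo_functor moved_part.
End Coinvariants.

Section CoinvariantsNat.
Context (F G : aut_functor) (a : F ~> G).
Hypothesis a_equiv : forall g x v, a x (af_act F g x v) = af_act G g x (a x v).

Let moved_nt x w :
  w \in moved_part F x -> tensor_nt idfun a x w \in moved_part G x.
Proof.
apply: span_of_map => {}w [g [t ->]]; exists g, (tensor_nt idfun a x t).
rewrite raddfB; congr (_ - _).
apply: (@tensor_ext _ _ _ _
  (tensor_nt idfun a x \o tensor_nt (am_act M g) (af_act F g) x)
  (tensor_nt (am_act M g) (af_act G g) x \o tensor_nt idfun a x)) => m v.
by rewrite /= !tens_mapE a_equiv.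
Qed.
Definition coinv_tensor_nt : coinv_tensor F ~> coinv_tensor G :=
  quo_nt moved_nt.
End CoinvariantsNat.

Let incl_equiv g x v :
  incl (common_kernel k B) x (af_act Q_upper_aut g x v) =
  af_act klin_aut g x (incl (common_kernel k B) x v).
Proof. by []. Qed.
Let proj_equiv g x v :
  proj (proper_part k B) x (af_act klin_aut g x v) =
  af_act Q_lower_aut g x (proj (proper_part k B) x v).
Proof. by rewrite /= quomod_mapE. Qed.

Definition Qmap : coinv_tensor Q_upper_aut ~> coinv_tensor Q_lower_aut :=
  nt_comp
    (@coinv_tensor_nt klin_aut Q_lower_aut (proj (proper_part k B)) proj_equiv)
    (@coinv_tensor_nt Q_upper_aut klin_aut (incl (common_kernel k B)) incl_equiv).

(* Q(B, M): [Qmap] is the composite map from the coinvariants of M (x) Q^B to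
   those of M (x) Q_B through those of M (x) k[B]. *)
Definition Qfunctor : functor C k := im_functor Qmap.
End CoinvariantTensor.
End AutActions.

(* Main.v *)
(* Since [C] is additive, an additive functor [A] of finite length has a single
   generator, hence finite values and, up to equality of their values, finitely
   many subfunctors. A series of [k[A]] is built by induction on the length of
   [A]: the sum of the images of the [k[P]], [P] a proper subfunctor, and the
   quotient of [k[A]] by the common kernel Q^A of the maps to the [k[A/N]], [N]
   nonzero, are dealt with by the induction hypothesis. What remains is Q_A,
   spanned by the generators of [A], on which Aut(A) acts freely. It is a
   quotient of the coinvariants of [M (x) Q_A] for a finite dimensional module
   [M], and by right exactness one may take [M] simple.

   For [M] simple, the image of [M (x) Q^A] in the coinvariants of [M (x) Q_A] is
   contained in every nonzero subfunctor. Indeed let [v = m (x) [b] + ...] be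
   nonzero, the other terms involving generators [c] not in the orbit of [b].
   There is a morphism [h] with [h c = 0] and [h b <> 0]; multiplying a linear
   combination of morphisms by [1 - avg_f [f h]], where the average exists by
   k-triviality, kills [c], and fixes the image of [b] as soon as this image lies
   in Q^A. So every [m (x) q], with [q] in Q^A, is obtained from [v] by a linear
   combination of morphisms. The cokernel of this image is a quotient of
   [k[A]/Q^A]. *)
From HB Require Import structures.
Require Import Defs.
From mathcomp Require Import all_boot all_order all_algebra.
From mathcomp Require Import generic_quotient ring_quotient boolp freeg.
(* [hom], [comp] and others are shadowed by the library. *)
Import Defs.

Set Implicit Arguments.
Unset Strict Implicit.
Unset Printing Implicit Defensive.

Import GRing.Theory.
Local Open Scope ring_scope.

(** * The lattice of subfunctors *)

Lemma submodB (R : pzRingType) (V : lmodType R) (S : submodClosed V) u v :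
  u \in S -> v \in S -> u - v \in S.
Proof. by move=> uS vS; rewrite -scaleN1r rpredD ?rpredZ. Qed.

Section SubfunctorLattice.
Context (C : preadditive) (R : pzRingType).
Implicit Types F G H : functor C R.

Section Bounds.
Context (F : functor C R).
Implicit Types P Q T : subfunctor F.

Section Zero.
Let Z x (v : F x) : Prop := v = 0.
Let Z0 x : @Z x 0. Proof. by []. Qed.
Let ZD x u v : @Z x u -> Z v -> Z (u + v).
Proof. by move=> -> ->; rewrite /Z addr0. Qed.
Let ZZ x a v : @Z x v -> Z (a *: v).
Proof. by move=> ->; rewrite /Z scaler0. Qed.
Let Z_stable x y (f : hom x y) v :
  v \in mk_submod (@Z0 x) (@ZD x) (@ZZ x) ->
  fmap F f v \in mk_submod (@Z0 y) (@ZD y) (@ZZ y).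
Proof. by move=> /mk_submodP ->; apply/mk_submodP; rewrite /Z raddf0. Qed.
Definition sf_zero : subfunctor F := SubFunctor Z_stable.
Lemma sf_zeroP x (v : F x) : v \in sf_zero x <-> v = 0.
Proof. by split=> [/mk_submodP|?] //; apply/mk_submodP. Qed.
End Zero.

Section Full.
Let Z x (v : F x) : Prop := True.
Let Z0 x : @Z x 0. Proof. by []. Qed.
Let ZD x u v : @Z x u -> Z v -> Z (u + v). Proof. by []. Qed.
Let ZZ x a v : @Z x v -> Z (a *: v). Proof. by []. Qed.
Let Z_stable x y (f : hom x y) v :
  v \in mk_submod (@Z0 x) (@ZD x) (@ZZ x) ->
  fmap F f v \in mk_submod (@Z0 y) (@ZD y) (@ZZ y).
Proof. by move=> _; apply/mk_submodP. Qed.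
Definition sf_full : subfunctor F := SubFunctor Z_stable.
Lemma sf_fullP : sub_full sf_full.
Proof. by move=> x v; apply/mk_submodP. Qed.
End Full.

Section Cap.
Context (P Q : subfunctor F).
Let Z x (v : F x) : Prop := v \in P x /\ v \in Q x.
Let Z0 x : @Z x 0. Proof. by split; apply: rpred0. Qed.
Let ZD x u v : @Z x u -> Z v -> Z (u + v).
Proof. by move=> [? ?] [? ?]; split; apply: rpredD. Qed.
Let ZZ x a v : @Z x v -> Z (a *: v).
Proof. by move=> [? ?]; split; apply: rpredZ. Qed.
Let Z_stable x y (f : hom x y) v :
  v \in mk_submod (@Z0 x) (@ZD x) (@ZZ x) ->
  fmap F f v \in mk_submod (@Z0 y) (@ZD y) (@ZZ y).
Proof. by move=> /mk_submodP[? ?]; apply/mk_submodP; split; apply: sub_stable. Qed.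
Definition sf_cap : subfunctor F := SubFunctor Z_stable.
Lemma sf_capP x (v : F x) : v \in sf_cap x <-> v \in P x /\ v \in Q x.
Proof. by split=> [/mk_submodP|?] //; apply/mk_submodP. Qed.
End Cap.

Section Add.
Context (P Q : subfunctor F).
Let Z x (v : F x) : Prop := exists u w, [/\ u \in P x, w \in Q x & v = u + w].
Let Z0 x : @Z x 0. Proof. by exists 0, 0; rewrite !rpred0 addr0. Qed.
Let ZD x u v : @Z x u -> Z v -> Z (u + v).
Proof.
move=> [a [b [aP bQ ->]]] [c [d [cP dQ ->]]]; exists (a + c), (b + d).
by rewrite addrACA; split=> //; apply: rpredD.
Qed.
Let ZZ x a v : @Z x v -> Z (a *: v).
Proof.
by move=> [b [c [? ? ->]]]; exists (a *: b), (a *: c); rewrite scalerDr !rpredZ.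
Qed.
Let Z_stable x y (f : hom x y) v :
  v \in mk_submod (@Z0 x) (@ZD x) (@ZZ x) ->
  fmap F f v \in mk_submod (@Z0 y) (@ZD y) (@ZZ y).
Proof.
move=> /mk_submodP[a [b [? ? ->]]]; apply/mk_submodP.
by exists (fmap F f a), (fmap F f b); rewrite raddfD !sub_stable.
Qed.
Definition sf_add : subfunctor F := SubFunctor Z_stable.
Lemma sf_addP x (v : F x) :
  v \in sf_add x <-> exists u w, [/\ u \in P x, w \in Q x & v = u + w].
Proof. by split=> [/mk_submodP|?] //; apply/mk_submodP. Qed.
End Add.

Lemma sub_le_trans P Q T : sub_le P Q -> sub_le Q T -> sub_le P T.
Proof. by move=> PQ QT x v /PQ/QT. Qed.
Lemma sub_le0 P : sub_le sf_zero P.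
Proof. by move=> x v /sf_zeroP ->; apply: rpred0. Qed.
Lemma sub_le1 P : sub_le P sf_full.
Proof. by move=> x v _; apply: sf_fullP. Qed.
Lemma sub_le_full P T : sub_full P -> sub_le T P.
Proof. by move=> full x v _; apply: full. Qed.
Lemma le_zeroP P : sub_le P sf_zero <-> sub_zero P.
Proof. by split=> h x v /h; [move/sf_zeroP | move=> ->; apply: rpred0]. Qed.
Lemma le_fullP P : sub_le sf_full P <-> sub_full P.
Proof. by split=> h x v => [|_]; [apply/h/sf_fullP | apply: h]. Qed.
Lemma not_zeroP P : ~ sub_zero P <-> exists x, exists2 v : F x, v \in P x & v <> 0.
Proof.
split=> [nz|[x [v vP v0]] z]; last by apply: v0; apply: z vP.
apply: contrapT => h; apply: nz => x v vP; apply: contrapT => v0.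
by apply: h; exists x, v.
Qed.
Lemma not_leP P Q :
  ~ sub_le P Q <-> exists x, exists2 v : F x, v \in P x & ~ (v \in Q x).
Proof.
split=> [nz|[x [v vP v0]] z]; last by apply: v0; apply: z vP.
apply: contrapT => h; apply: nz => x v vP; apply: contrapT => v0.
by apply: h; exists x, v.
Qed.

Lemma cap_lel P Q : sub_le (sf_cap P Q) P. Proof. by move=> x v /sf_capP[]. Qed.
Lemma cap_ler P Q : sub_le (sf_cap P Q) Q. Proof. by move=> x v /sf_capP[]. Qed.
Lemma le_cap P Q T : sub_le T P -> sub_le T Q -> sub_le T (sf_cap P Q).
Proof. by move=> TP TQ x v vT; apply/sf_capP; split; [apply: TP|apply: TQ]. Qed.
Lemma le_addl P Q : sub_le P (sf_add P Q).
Proof. by move=> x v vP; apply/sf_addP; exists v, 0; rewrite rpred0 addr0. Qed.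
Lemma le_addr P Q : sub_le Q (sf_add P Q).
Proof. by move=> x v vP; apply/sf_addP; exists 0, v; rewrite rpred0 add0r. Qed.
Lemma add_le P Q T : sub_le P T -> sub_le Q T -> sub_le (sf_add P Q) T.
Proof. by move=> PT QT x v /sf_addP[a [b [/PT ? /QT ? ->]]]; apply: rpredD. Qed.
End Bounds.

Section Image.
Context (F G : functor C R) (a : F ~> G) (P : subfunctor F).
Let Z x (w : G x) : Prop := exists2 v, v \in P x & w = a x v.
Let Z0 x : @Z x 0. Proof. by exists 0; rewrite ?rpred0 ?raddf0. Qed.
Let ZD x u v : @Z x u -> Z v -> Z (u + v).
Proof. by move=> [b ? ->] [c ? ->]; exists (b + c); rewrite ?rpredD ?raddfD. Qed.
Let ZZ x c v : @Z x v -> Z (c *: v).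
Proof. by move=> [b ? ->]; exists (c *: b); rewrite ?rpredZ ?linearZ. Qed.
Let Z_stable x y (f : hom x y) v :
  v \in mk_submod (@Z0 x) (@ZD x) (@ZZ x) ->
  fmap G f v \in mk_submod (@Z0 y) (@ZD y) (@ZZ y).
Proof.
move=> /mk_submodP[b ? ->]; apply/mk_submodP.
by exists (fmap F f b); rewrite ?ntm_nat ?sub_stable.
Qed.
Definition sf_img : subfunctor G := SubFunctor Z_stable.
Lemma sf_imgP x (w : G x) : w \in sf_img x <-> exists2 v, v \in P x & w = a x v.
Proof. by split=> [/mk_submodP|?] //; apply/mk_submodP. Qed.
Lemma mem_img x v : v \in P x -> a x v \in sf_img x.
Proof. by move=> vP; apply/sf_imgP; exists v. Qed.
End Image.

Lemma sub_preimE F G (a : F ~> G) (Q : subfunctor G) x v :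
  (v \in sub_preim a Q x) = (a x v \in Q x).
Proof. exact: submod_preimE. Qed.

Lemma img_le F G (a : F ~> G) (P Q : subfunctor F) :
  sub_le P Q -> sub_le (sf_img a P) (sf_img a Q).
Proof. by move=> PQ x v /sf_imgP[u /PQ uQ ->]; apply: mem_img. Qed.
Lemma preim_le F G (a : F ~> G) (P Q : subfunctor G) :
  sub_le P Q -> sub_le (sub_preim a P) (sub_preim a Q).
Proof. by move=> PQ x v; rewrite !sub_preimE; apply: PQ. Qed.

(** Covering relation of the lattice of subfunctors, with mutual inclusion in place of equality. By
    [simple_coverP] it expresses the simplicity of [Q / P] without forming a quotient. *)
Definition cover F (P Q : subfunctor F) : Prop :=
  [/\ sub_le P Q, ~ sub_le Q P & forall T : subfunctor F,
      sub_le P T -> sub_le T Q -> sub_le T P \/ sub_le Q T].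

Lemma isomorphic_refl F : isomorphic F F.
Proof. by exists (nt_id F), (nt_id F); split. Qed.
Lemma isomorphic_sym F G : isomorphic F G -> isomorphic G F.
Proof. by move=> [a [b [ab ba]]]; exists b, a. Qed.
Lemma isomorphic_trans F G H : isomorphic F G -> isomorphic G H -> isomorphic F H.
Proof.
move=> [a [b [ab ba]]] [c [d [cd dc]]]; exists (nt_comp c a), (nt_comp b d).
by split=> x v /=; rewrite ?cd ?ab ?ba ?dc.
Qed.

Section Bijective.
Context (F G : functor C R) (a : F ~> G).
Hypothesis a_inj : forall x v, a x v = 0 -> v = 0.
Hypothesis a_surj : forall x w, exists v, a x v = w.

Let inv x (w : G x) : F x := projT1 (cid (a_surj w)).
Let invK x w : a x (inv w) = w. Proof. exact: projT2 (cid (a_surj w)). Qed.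
Let a_injective x : injective (a x).
Proof. by move=> u v e; apply/subr0_eq/a_inj; rewrite linearB e subrr. Qed.
Let inv_linear x : linear (@inv x).
Proof. by move=> c u v; apply: a_injective; rewrite linearP !invK. Qed.
HB.instance Definition _ x :=
  GRing.isLinear.Build R (G x) (F x) *:%R (@inv x) (@inv_linear x).
Let inv_nat x y (f : hom x y) v :
  (@inv y : {linear _ -> _}) (fmap G f v) = fmap F f ((@inv x : {linear _ -> _}) v).
Proof. by apply: a_injective; rewrite ntm_nat !invK. Qed.

Lemma bijective_inverse : exists b : G ~> F,
  (forall x, cancel (a x) (b x)) /\ (forall x, cancel (b x) (a x)).
Proof.
exists (@NatTrans C R G F (fun x => @inv x : {linear _ -> _}) inv_nat).
by split=> x v; rewrite /= ?invK //; apply: a_injective; rewrite invK.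
Qed.

Lemma bijective_isomorphic : isomorphic F G.
Proof. by have [b ab] := bijective_inverse; exists a, b. Qed.
End Bijective.

Definition sq_elt F (P Q : subfunctor F) x (v : F x) (vQ : v \in Q x) :
  subquo Q P x := qpi (sub_preim (incl Q) P x) (SubModule vQ).

Lemma sq_elt_surj F (P Q : subfunctor F) x (w : subquo Q P x) :
  exists v (vQ : v \in Q x), w = sq_elt P vQ.
Proof. by rewrite -[w]qreprK; case: (qrepr w) => v vQ; exists v, vQ. Qed.

Lemma sq_elt_eq0 F (P Q : subfunctor F) x (v : F x) (vQ : v \in Q x) :
  sq_elt P vQ = 0 <-> v \in P x.
Proof.
split=> [/qpi_eq0P|vP]; first by rewrite sub_preimE.
by apply/qpi_eq0P; rewrite sub_preimE.
Qed.

Lemma sq_elt_eq F (P Q : subfunctor F) x (u v : F x) (uQ : u \in Q x) (vQ : v \in Q x) :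
  sq_elt P uQ = sq_elt P vQ <-> u - v \in P x.
Proof.
split=> [/qpiP|h]; first by rewrite submod_preimE.
by apply/qpiP; rewrite submod_preimE.
Qed.

Section SubquoIso.
Context (F G : functor C R) (a : F ~> G).
Context (P Q : subfunctor F) (P' Q' : subfunctor G).
Hypothesis aQ : forall x v, v \in Q x -> a x v \in Q' x.
Hypothesis aP : forall x v, v \in Q x -> v \in P x -> a x v \in P' x.

Let a1 : sub_functor Q ~> sub_functor Q' := sub_nt aQ.
Let a1P x v : v \in sub_preim (incl Q) P x -> a1 x v \in sub_preim (incl Q') P' x.
Proof. by rewrite !sub_preimE; apply: aP; apply: valP. Qed.

Definition sq_map : subquo Q P ~> subquo Q' P' := quo_nt a1P.

Lemma sq_mapE x v (vQ : v \in Q x) : sq_map x (sq_elt P vQ) = sq_elt P' (aQ vQ).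
Proof.
rewrite /sq_map /= quomod_mapE; congr qpi; exact: val_inj.
Qed.

(** The two conditions are injectivity and surjectivity of the induced map [sq_map]. Most
    isomorphisms between subquotients below are instances. *)
Lemma subquo_iso :
  (forall x v, v \in Q x -> a x v \in P' x -> v \in P x) ->
  (forall x w, w \in Q' x -> exists2 v, v \in Q x & w - a x v \in P' x) ->
  isomorphic (subquo Q P) (subquo Q' P').
Proof.
move=> inj surj; apply: (@bijective_isomorphic _ _ sq_map) => x v.
  have [u [uQ ->]] := sq_elt_surj v; rewrite sq_mapE => /sq_elt_eq0 h.
  exact/sq_elt_eq0/inj.
have [w [wQ ->]] := sq_elt_surj v; have [u uQ e] := surj x w wQ.
by exists (sq_elt P uQ); rewrite sq_mapE; apply/esym/sq_elt_eq.
Qed.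
End SubquoIso.

Lemma subquo_equiv F (P Q P' Q' : subfunctor F) :
  sub_le P P' -> sub_le P' P -> sub_le Q Q' -> sub_le Q' Q ->
  isomorphic (subquo Q P) (subquo Q' P').
Proof.
move=> p p' q q'; apply: (@subquo_iso _ _ (nt_id F)) => x v //=.
- exact: q.
- by move=> _; apply: p.
- by move=> _; apply: p'.
- by move=> /q' ?; exists v; rewrite // subrr rpred0.
Qed.

(** Subfunctors of [Q / P] correspond, by image and preimage, to the subfunctors of [F] between [P]
    and [Q]. *)
Lemma simple_coverP F (P Q : subfunctor F) :
  sub_le P Q -> simple_functor (subquo Q P) <-> cover P Q.
Proof.
move=> PQ.
have prE x v (vQ : v \in Q x) : proj (sub_preim (incl Q) P) x (SubModule vQ) = sq_elt P vQ by [].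
split=> [[[x [w w0]] simp]|[_ QP simp]].
  split=> // [QP|T PT TQ].
    by move: w0; have [v [vQ ->]] := sq_elt_surj w => /eqP; apply; apply/sq_elt_eq0/QP.
  pose T' := sf_img (proj (sub_preim (incl Q) P)) (sub_preim (incl Q) T).
  case: (simp T') => h; [left=> y v vT | right=> y v vQ].
    apply/(sq_elt_eq0 P (TQ _ _ vT))/h.
    by rewrite -prE; apply: mem_img; rewrite sub_preimE.
  have /sf_imgP[[u uQ]] := h y (sq_elt P vQ); rewrite sub_preimE /= => uT.
  move/sq_elt_eq => /PT e.
  by rewrite -(subrK u v) rpredD.
split.
  have [x [v vQ vP]] := (not_leP _ _).1 QP.
  by exists x, (sq_elt P vQ); apply/eqP => /sq_elt_eq0.
move=> T; pose T' := sf_img (incl Q) (sub_preim (proj (sub_preim (incl Q) P)) T).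
have T'P x v (vQ : v \in Q x) : v \in T' x <-> sq_elt P vQ \in T x.
  split=> [/sf_imgP[[u uQ]]|h]; last first.
    by apply/sf_imgP; exists (SubModule vQ); rewrite // sub_preimE.
  rewrite sub_preimE prE /= => h e; subst u.
  by rewrite (bool_irrelevance vQ uQ).
case: (simp T').
- move=> x v vP; apply/(T'P _ _ (PQ _ _ vP)).
  by rewrite (sq_elt_eq0 P (PQ _ _ vP)).2 ?rpred0.
- by move=> x v /sf_imgP[[u uQ] _ ->].
- move=> h; left=> x w; have [v [vQ ->]] := sq_elt_surj w.
  by move/T'P/h => vP; apply/sq_elt_eq0.
- move=> h; right=> x w; have [v [vQ ->]] := sq_elt_surj w.
  exact/T'P/h.
Qed.

Lemma cover_equiv F (P Q P' Q' : subfunctor F) :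
  sub_le P P' -> sub_le P' P -> sub_le Q Q' -> sub_le Q' Q -> cover P Q -> cover P' Q'.
Proof.
move=> p p' q q' [PQ QP h]; split.
- exact: sub_le_trans p' (sub_le_trans PQ q).
- by move=> l; apply/QP/(sub_le_trans q (sub_le_trans l p')).
- move=> T PT TQ; case: (h T); [exact: sub_le_trans PT|exact: sub_le_trans q'| |].
    by move=> ?; left; apply: sub_le_trans p.
  by move=> ?; right; apply: sub_le_trans q' _.
Qed.
End SubfunctorLattice.

(** * Series with prescribed factors *)

Section Series.
Context (C : preadditive) (R : pzRingType) (PP : functor C R -> Prop).
Implicit Types F G : functor C R.

(** With [PP] as a parameter, a single construction of series yields both finite length ([PP]
    trivial) and the shape of the factors. *)
Inductive ser F (P : subfunctor F) : subfunctor F -> Prop :=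
| ser_nil Q : sub_le P Q -> sub_le Q P -> ser P Q
| ser_cons Q T : ser P Q -> cover Q T -> PP (subquo T Q) -> ser P T.

Lemma ser_le F (P Q : subfunctor F) : ser P Q -> sub_le P Q.
Proof.
by elim=> // {}Q T _ PQ [QT _ _] _; apply: sub_le_trans QT.
Qed.

Hypothesis PP_iso : forall F G, isomorphic F G -> PP F -> PP G.

Lemma ser_equivr F (P Q Q' : subfunctor F) :
  ser P Q -> sub_le Q Q' -> sub_le Q' Q -> ser P Q'.
Proof.
move=> s; case: s Q' => {}Q.
  move=> PQ QP Q' QQ' Q'Q; apply: ser_nil; first exact: sub_le_trans QQ'.
  exact: sub_le_trans QP.
move=> T s cov pp Q' TQ' Q'T; apply: ser_cons s _ _.
  exact: cover_equiv cov.
by apply: PP_iso pp; apply: subquo_equiv.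
Qed.

Lemma ser_trans F (P Q T : subfunctor F) : ser P Q -> ser Q T -> ser P T.
Proof.
move=> PQ; elim=> [{}T QT TQ|T' T'' _ PT' cov pp]; first exact: ser_equivr PQ QT TQ.
exact: ser_cons PT' cov pp.
Qed.

Lemma ser_equivl F (P P' Q : subfunctor F) :
  ser P Q -> sub_le P P' -> sub_le P' P -> ser P' Q.
Proof. by move=> s PP' P'P; apply: ser_trans s; apply: ser_nil. Qed.

(** A simple step may be collapsed by [phi]; otherwise it survives with an isomorphic factor. This
    is what carries a series of [F] to one of [G]. *)
Definition step_transport F G (phi : subfunctor F -> subfunctor G) : Prop :=
  (forall P Q, sub_le P Q -> sub_le (phi P) (phi Q)) /\
  forall P Q, cover P Q -> sub_le (phi Q) (phi P) \/
    (cover (phi P) (phi Q) /\ isomorphic (subquo Q P) (subquo (phi Q) (phi P))).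

Lemma ser_transport F G (phi : subfunctor F -> subfunctor G) (P Q : subfunctor F) :
  step_transport phi -> ser P Q -> ser (phi P) (phi Q).
Proof.
move=> [mono step]; elim=> [{}Q PQ QP|{}Q T _ s cov pp].
  by apply: ser_nil; apply: mono.
have QT : sub_le Q T by case: cov.
case: (step _ _ cov) => [le|[cov' iso]].
  by apply: ser_equivr s _ le; apply: mono.
by apply: ser_cons s cov' _; apply: PP_iso pp.
Qed.
End Series.

(** * Images and preimages of series *)

Section Transport.
Context (C : preadditive) (R : pzRingType).
Implicit Types F G : functor C R.

Lemma cover_isom F G (P Q : subfunctor F) (P' Q' : subfunctor G) :
  sub_le P Q -> sub_le P' Q' -> isomorphic (subquo Q P) (subquo Q' P') ->
  cover P Q -> cover P' Q'.
Proof.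
move=> PQ P'Q' [a [b [ab ba]]] /(simple_coverP PQ) [[x [v v0]] simp].
apply/(simple_coverP P'Q'); split.
  exists x, (a x v); apply/eqP => e; move/eqP: v0; apply.
  by rewrite -[v]ab e linear0.
move=> T; case: (simp (sub_preim a T)) => h; [left|right]; move=> y w.
  move=> wT; rewrite -[w]ba (h _ (b y w)) ?linear0 //.
  by rewrite sub_preimE ba.
by have := h y (b y w); rewrite sub_preimE ba.
Qed.

(** Let [P'] and [Q'] correspond to a cover [P < Q]. The sum of [P] and the image of [Q'] lies
    between [P] and [Q]: if it is [P] the step collapses, and if it is [Q] then [a] induces an
    isomorphism from [Q' / P'] to [Q / P]. *)
Lemma transport_preim F G (a : F ~> G) (T : subfunctor F) :
  step_transport (fun P => sf_cap (sub_preim a P) T).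
Proof.
split=> [P Q PQ|P Q [PQ QP simp]].
  apply: le_cap; last exact: cap_ler.
  by apply: sub_le_trans (@cap_lel _ _ _ _ _) _; apply: preim_le.
set P' := sf_cap (sub_preim a P) T; set Q' := sf_cap (sub_preim a Q) T.
have P'Q' : sub_le P' Q'.
  by apply: le_cap; [apply: sub_le_trans (@cap_lel _ _ _ _ _) _; apply: preim_le PQ|apply: cap_ler].
case: (simp (sf_add P (sf_img a Q'))); first exact: le_addl.
- apply: add_le => // x v /sf_imgP[w /sf_capP[]].
  by rewrite sub_preimE => ? _ ->.
- move=> h; left=> x v vQ'; move/sf_capP: (vQ') => [_ vT]; apply/sf_capP.
  by split=> //; rewrite sub_preimE; apply/h/le_addr/mem_img.
move=> h.
have iso : isomorphic (subquo Q' P') (subquo Q P).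
  apply: (@subquo_iso _ _ _ _ a).
  - by move=> x v /sf_capP[]; rewrite sub_preimE.
  - by move=> x v _ /sf_capP[]; rewrite sub_preimE.
  - by move=> x v /sf_capP[_ vT] avP; apply/sf_capP; rewrite sub_preimE.
  - move=> x w /h/sf_addP[p [q [pP /sf_imgP[v vQ' ->] ->]]].
    by exists v; rewrite // addrK.
right; split; last exact: isomorphic_sym.
by apply: cover_isom (isomorphic_sym iso) _.
Qed.

(** Dually, the intersection of [Q] with the preimage of [P'] lies between [P] and [Q]: if it is [Q]
    the step collapses, and if it is [P] then [a] induces an isomorphism from [Q / P] to
    [Q' / P']. *)
Lemma transport_img F G (a : F ~> G) (T : subfunctor G) :
  step_transport (fun P => sf_add (sf_img a P) T).
Proof.
split=> [P Q PQ|P Q [PQ QP simp]].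
  apply: add_le; last exact: le_addr.
  by apply: sub_le_trans (img_le PQ) (@le_addl _ _ _ _ _).
set P' := sf_add (sf_img a P) T; set Q' := sf_add (sf_img a Q) T.
have P'Q' : sub_le P' Q'.
  by apply: add_le; [apply: sub_le_trans (img_le PQ) (@le_addl _ _ _ _ _)|apply: le_addr].
case: (simp (sf_cap Q (sub_preim a P'))); last 1 first.
- move=> h; left; apply: add_le; last exact: le_addr.
  by move=> x v /sf_imgP[w /h/sf_capP[_ w'] ->]; rewrite sub_preimE in w'.
- apply: le_cap => // x v vP; rewrite sub_preimE.
  by apply/le_addl/mem_img.
- exact: cap_lel.
move=> h.
have iso : isomorphic (subquo Q P) (subquo Q' P').
  apply: (@subquo_iso _ _ _ _ a).
  - by move=> x v vQ; apply/le_addl/mem_img.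
  - by move=> x v _ vP; apply/le_addl/mem_img.
  - by move=> x v vQ avP; apply: h; apply/sf_capP; rewrite sub_preimE.
  - move=> x w /sf_addP[_ [q [/sf_imgP[v vQ ->] qT ->]]].
    by exists v; rewrite // addrC addKr; apply: le_addr.
by right; split=> //; apply: cover_isom iso _.
Qed.
End Transport.

Section SeriesTheory.
Context (C : preadditive) (R : pzRingType) (PP : functor C R -> Prop).
Hypothesis PP_iso : forall F G, isomorphic F G -> PP F -> PP G.
Implicit Types F G : functor C R.
Local Notation ser := (ser PP).

Lemma ser_preim F G (a : F ~> G) T (P Q : subfunctor G) :
  ser P Q -> ser (sf_cap (sub_preim a P) T) (sf_cap (sub_preim a Q) T).
Proof. exact: (ser_transport PP_iso (transport_preim a T)). Qed.

Lemma ser_img F G (a : F ~> G) T (P Q : subfunctor F) :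
  ser P Q -> ser (sf_add (sf_img a P) T) (sf_add (sf_img a Q) T).
Proof. exact: (ser_transport PP_iso (transport_img a T)). Qed.

Lemma ser_cap F (T P Q : subfunctor F) : ser P Q -> ser (sf_cap P T) (sf_cap Q T).
Proof.
move/(ser_preim (nt_id F) T).
have h S : sub_le (sf_cap (sub_preim (nt_id F) S) T) (sf_cap S T) /\
           sub_le (sf_cap S T) (sf_cap (sub_preim (nt_id F) S) T).
  by split=> x v /sf_capP h; apply/sf_capP; rewrite sub_preimE in h *.
have [? ?] := h P; have [? ?] := h Q.
by move=> s; apply: (ser_equivl PP_iso (ser_equivr PP_iso s _ _)).
Qed.

Lemma ser_add F (T P Q : subfunctor F) : ser P Q -> ser (sf_add P T) (sf_add Q T).
Proof.
move/(ser_img (nt_id F) T).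
have h S : sub_le (sf_img (nt_id F) S) S /\ sub_le S (sf_img (nt_id F) S).
  by split=> x v; [case/sf_imgP=> w wS -> | move=> vS; apply/sf_imgP; exists v].
have h' S : sub_le (sf_add (sf_img (nt_id F) S) T) (sf_add S T) /\
            sub_le (sf_add S T) (sf_add (sf_img (nt_id F) S) T).
  have [h1 h2] := h S.
  by split; (apply: add_le; last exact: le_addr); [move: h1|move: h2] => hh;
     apply: sub_le_trans hh (@le_addl _ _ _ _ _).
have [? ?] := h' P; have [? ?] := h' Q.
by move=> s; apply: (ser_equivl PP_iso (ser_equivr PP_iso s _ _)).
Qed.

(* Jordan-Hoelder: [T |-> (T :&: Q) + P] sends a series of [F] to one from [P]
   to [Q], whose only proper step is the simple quotient [Q / P]. *)
Lemma ser_cover F (P Q : subfunctor F) :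
  ser (sf_zero F) (sf_full F) -> cover P Q -> PP (subquo Q P).
Proof.
move=> s [PQ QP simp].
have {}s : ser P Q.
  have := ser_add P (ser_cap Q s).
  move=> {}s; apply: (ser_equivl PP_iso (ser_equivr PP_iso s _ _)).
  - by apply: add_le => //; apply: cap_ler.
  - by move=> x v vQ; apply/le_addl/sf_capP; split=> //; apply: sf_fullP.
  - by apply: add_le => // x v /sf_capP[/sf_zeroP -> _]; apply: rpred0.
  - exact: le_addr.
case: s PQ QP simp => {}Q; first by [].
move=> T s [QT TQ simp'] pp PT TP simp.
case: (simp Q) => //; first exact: ser_le s.
by move=> QP; apply: PP_iso pp; apply: subquo_equiv => //; apply: ser_le s.
Qed.

Lemma ser_composition F (P Q : subfunctor F) : ser P Q ->
  exists n (s : nat -> subfunctor F), [/\ s 0 = P, sub_le (s n) Q, sub_le Q (s n)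
    & forall i, (i < n)%N -> cover (s i) (s i.+1) /\ PP (subquo (s i.+1) (s i))].
Proof.
elim=> [{}Q PQ QP|{}Q T _ [n [s [s0 sQ Qs cov]]] QT pp].
  by exists 0%N, (fun=> P).
exists n.+1, (fun i => if (i <= n)%N then s i else T).
rewrite leq0n s0 ltnn; split=> // i /ltnSE; case: (ltngtP i n) => // [lt|->] _; first by apply: cov.
split; first exact: cover_equiv QT.
by apply: PP_iso pp; apply: subquo_equiv.
Qed.

Lemma composition_ser F n (s : nat -> subfunctor F) :
  composition_series n s ->
  (forall i, (i < n)%N -> PP (subquo (s i.+1) (s i))) -> ser (sf_zero F) (sf_full F).
Proof.
move=> [s0 sn sle ssimp] pp.
have : ser (s 0) (s n).
  elim: {sn}n sle ssimp pp => [|n IH] sle ssimp pp; first exact: ser_nil.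
  apply: (ser_cons (Q := s n)); last exact: pp.
    by apply: IH => i lt; [apply: sle|apply: ssimp|apply: pp]; apply: ltnW.
  by apply/simple_coverP; [apply: sle|apply: ssimp].
move=> s'; apply: (ser_equivl PP_iso (ser_equivr PP_iso s' _ _)).
- exact: sub_le1.
- exact: sub_le_full.
- exact/le_zeroP.
- exact: sub_le0.
Qed.
End SeriesTheory.

(** * Finite length and composition factors *)

Section FiniteLength.
Context (C : preadditive) (R : pzRingType).
Implicit Types F G S : functor C R.
Let top := fun _ : functor C R => True.

Lemma finite_length_ser F : finite_length F <-> ser top (sf_zero F) (sf_full F).
Proof.
split=> [[n [s cs]]|/ser_composition[] // n [s [s0 sQ Qs cov]]].
  exact: composition_ser cs _.
exists n, s; split.
- by rewrite s0 => x v /sf_zeroP.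
- exact/le_fullP.
- by move=> i /cov[[]].
- by move=> i /cov[cv _]; apply/simple_coverP => //; case: cv.
Qed.

Lemma ser_finite_length (PP : functor C R -> Prop) F :
  (forall F G, isomorphic F G -> PP F -> PP G) ->
  ser PP (sf_zero F) (sf_full F) -> finite_length F.
Proof.
move=> PP_iso s; apply/finite_length_ser.
by elim: s => [Q|Q T _ s cov _]; [apply: ser_nil|apply: ser_cons s cov _].
Qed.

(** A series can be made to pass through any cover [P < Q]: intersecting a series of [F] with [P]
    gives one from zero to [P], and adding [Q] gives one from [Q] to the top. *)
Lemma composition_factorP F S : finite_length F ->
  composition_factor S F <-> exists P Q : subfunctor F, cover P Q /\ isomorphic S (subquo Q P).
Proof.
move=> flF; split=> [[n [s [[_ _ sle ssimp] [i lt iso]]]]|[P [Q [cov iso]]]].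
  exists (s i), (s i.+1); split=> //.
  by apply/simple_coverP; [apply: sle|apply: ssimp].
have tt : forall F G, isomorphic F G -> top F -> top G by [].
have s := (finite_length_ser F).1 flF.
have sP : ser top (sf_zero F) P.
  apply: (ser_equivl tt (ser_equivr tt (ser_cap tt P s) _ _)).
  - exact: cap_ler.
  - by apply: le_cap => //; apply: sub_le1.
  - exact: cap_lel.
  - by apply: le_cap => //; apply: sub_le0.
have sQ : ser top Q (sf_full F).
  apply: (ser_equivl tt (ser_equivr tt (ser_add tt Q s) _ _)).
  - exact: sub_le1.
  - exact: le_addl.
  - by apply: add_le => //; apply: sub_le0.
  - exact: le_addr.
have [n [s1 [s10 s1P Ps1 cov1]]] := ser_composition tt sP.
have [m [s2 [s20 s2P Ps2 cov2]]] := ser_composition tt sQ.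
(* Steps before [n] come from [s1], step [n] goes from [P] to [Q], and [s2] is shifted by [n.+1]. *)
pose t i := if (i <= n)%N then s1 i else s2 (i - n.+1)%N.
have tn : t n = s1 n by rewrite /t leqnn.
have tn1 : t n.+1 = Q by rewrite /t ltnn subnn s20.
have cv i : (i < n.+1 + m)%N -> cover (t i) (t i.+1).
  case: (ltngtP i n) => [lt _|lt lt'|-> _].
  - by rewrite /t (ltnW lt) lt; apply: (cov1 i lt).1.
  - rewrite /t leqNgt lt /= leqNgt (leqW lt) /= subSn //.
    by apply: (cov2 _ _).1; rewrite ltn_subLR.
  - by rewrite tn tn1; apply: cover_equiv cov.
exists (n.+1 + m)%N, t; split; last first.
  exists n; first by rewrite leq_addr.
  rewrite tn tn1; apply: isomorphic_trans iso _; exact: subquo_equiv.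
split.
- by rewrite /t leq0n s10 => x v /sf_zeroP.
- have -> : t (n.+1 + m)%N = s2 m by rewrite /t addSn ltnNge leq_addr /= -addSn addKn.
  exact/le_fullP.
- by move=> i /cv[].
- by move=> i /cv cvi; apply/simple_coverP => //; case: cvi.
Qed.
End FiniteLength.

(** * Rank functions and generators *)

Section HasRank.
Context (C : preadditive) (R : pzRingType).
Implicit Types F G : functor C R.

(** A substitute for the length. Existence of a bounded strictly increasing function is equivalent
    to finite length, by [finite_length_rank] and [has_rank_finite_length], and such a function is
    easily pulled back along order embeddings. *)
Definition has_rank F (n : nat) : Prop := exists h : subfunctor F -> nat,
  (forall P Q, sub_le P Q -> ~ sub_le Q P -> (h P < h Q)%N) /\
  forall P, (h P <= n)%N.

End HasRank.

(** Two rings are allowed because [klin_rank] compares the subfunctors of [A] with those of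
    [k[A]]. *)
Lemma has_rank_embed (C : preadditive) (R R' : pzRingType) (F : functor C R)
    (G : functor C R') n (psi : subfunctor G -> subfunctor F) :
  (forall P Q, sub_le P Q -> sub_le (psi P) (psi Q)) ->
  (forall P Q, sub_le (psi P) (psi Q) -> sub_le P Q) ->
  has_rank F n -> has_rank G n.
Proof.
move=> mono refl [h [strict bound]]; exists (h \o psi); split=> //= P Q PQ QP.
by apply: strict; [apply: mono|move/refl].
Qed.

Section Rank.
Context (C : preadditive) (R : pzRingType).
Implicit Types F G : functor C R.

(* The rank of [P] counts the steps of a series [s] in which [P] takes part. *)
Lemma finite_length_rank F : finite_length F -> exists n, has_rank F n.
Proof.
move=> [n [s [s0 sn sle ssimp]]]; exists n.
pose b i (P : subfunctor F) := `[< ~ sub_le (sf_cap (s i.+1) P) (s i) >].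
have b_mono i P Q : sub_le P Q -> b i P -> b i Q.
  move=> PQ /asboolP h; apply/asboolP => h'; apply: h.
  apply: sub_le_trans h'; apply: le_cap; first exact: cap_lel.
  exact: sub_le_trans (@cap_ler _ _ _ _ _) PQ.
exists (fun P => \sum_(i < n) b i P)%N; split; last first.
  move=> P; rewrite -[leqRHS]card_ord -sum1_card; apply: leq_sum => i _.
  exact: leq_b1.
move=> P Q PQ QP; rewrite ltnNge; apply/negP => hle; apply: QP.
have bPQ i : (i < n)%N -> b i Q -> b i P.
  move=> lt bQ; apply: contraLR hle => bP; rewrite -ltnNge.
  rewrite (bigD1 (Ordinal lt)) //= (negPf bP) add0n.
  rewrite [ltnRHS](bigD1 (Ordinal lt)) //= bQ ltnS.
  by apply: leq_sum => j _; case bP': (b j P) => //; rewrite (b_mono _ _ _ PQ bP').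
suff h i : (i <= n)%N -> sub_le (sf_cap (s i) Q) P.
  by move=> x v vQ; apply: (h n) => //; apply/sf_capP; split=> //; apply: sn.
elim: i => [_|i IH lt]; first by move=> x v /sf_capP[/s0 -> _]; apply: rpred0.
have [bQ|/asboolP/contrapT bQ] := boolP (b i Q); last first.
  move=> x v vQ; apply: IH; first exact: ltnW.
  by apply/sf_capP; split; [apply: bQ|apply: cap_ler vQ].
have /asboolP bP := bPQ i lt bQ.
(* [P] takes part in step [i], so by simplicity every element of [s i.+1] is the sum of one of [s i]
   and one of [P]. The induction hypothesis absorbs the first summand. *)
have [_ _ /(_ (sf_add (s i) (sf_cap (s i.+1) P)))] :=
  (simple_coverP (sle _ lt)).1 (ssimp _ lt).
case; first exact: le_addl.
- by apply: add_le; [apply: sle|apply: cap_lel].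
- by move=> h; case: bP; apply: sub_le_trans h; apply: le_addr.
move=> h x v /sf_capP[vs vQ]; have /sf_addP[t [p [ts /sf_capP[_ pP] e]]] := h x v vs.
have tQ : t \in Q x by rewrite -(addrK p t) -e; apply: submodB => //; apply: PQ.
rewrite e rpredD //; apply: (IH (ltnW lt)); exact/sf_capP.
Qed.

(** A subfunctor of least rank among those strictly above [P] covers [P]. *)
Lemma cover_above F n (P : subfunctor F) : has_rank F n -> ~ sub_full P ->
  exists Q, cover P Q.
Proof.
move=> [h [strict bound]] nfull.
pose p m := `[< exists Q, [/\ sub_le P Q, ~ sub_le Q P & h Q = m] >].
have [m /asboolP[Q [PQ QP hQ]] min] : exists2 m, p m & forall i, p i -> (m <= i)%N.
  have ex : exists m, p m.
    exists (h (sf_full F)); apply/asboolP; exists (sf_full F).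
    by split; [apply: sub_le1 | move/le_fullP |].
  by exists (ex_minn ex); case: ex_minnP.
exists Q; split=> // T PT TQ; have [TP|TP] := pselect (sub_le T P); [by left|right].
apply: contrapT => QT; have := strict _ _ TQ QT; rewrite hQ ltnNge min //.
by apply/asboolP; exists T.
Qed.

Lemma has_rank_finite_length F n : has_rank F n -> finite_length F.
Proof.
move=> hF; have [h [strict bound]] := hF; apply/finite_length_ser.
have tt : forall F G : functor C R, isomorphic F G -> True -> True by [].
suff s m P : (n - h P < m)%N -> ser (fun=> True) P (sf_full F) by apply: s (ltnSn _).
elim: m P => // m IH P lt; have [full|nfull] := pselect (sub_full P).
  by apply: ser_nil; [apply: sub_le1|apply: sub_le_full].
have [Q cov] := cover_above hF nfull; have [PQ QP _] := cov.
apply: (@ser_trans _ _ _ tt _ _ Q); last apply: IH.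
  by apply: (@ser_cons _ _ _ _ _ P) => //; apply: ser_nil.
have ltQ := strict _ _ PQ QP; apply: leq_trans (ltnSE lt); rewrite ltn_sub2l //.
exact: leq_trans ltQ (bound Q).
Qed.

(** Subfunctors of a proper subfunctor have rank below that of [F] itself. The strict drop of the
    bound drives the induction in [ser_klin]. *)
Lemma has_rank_sub F n (P : subfunctor F) : has_rank F n -> ~ sub_full P ->
  exists2 m, (m < n)%N & has_rank (sub_functor P) m.
Proof.
move=> [h [strict bound]] nfull.
have lt T : sub_le T P -> (h T < n)%N.
  move=> TP; apply: leq_trans (bound (sf_full F)); apply: strict; first exact: sub_le1.
  by move=> full; apply: nfull; apply/le_fullP/(sub_le_trans full).
have imP T : sub_le (sf_img (incl P) T) P by move=> x v /sf_imgP[[u uP] _ ->].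
have n0 : (0 < n)%N by apply: leq_trans (lt P _).
exists n.-1; first by rewrite prednK.
exists (fun T => h (sf_img (incl P) T)); split=> [S T ST TS|T]; last first.
  by rewrite -ltnS prednK // lt.
apply: strict; first exact: img_le.
move=> le; apply: TS => x v vT.
by have /le/sf_imgP[w wS /val_inj ->] := mem_img (incl P) vT.
Qed.

(** Preimages in [F] contain the nonzero [N], hence have positive rank; subtracting one from all
    ranks lowers the bound. *)
Lemma has_rank_quo F n (N : subfunctor F) : has_rank F n -> ~ sub_zero N ->
  exists2 m, (m < n)%N & has_rank (quo_functor N) m.
Proof.
move=> [h [strict bound]] nz.
have gt T : (0 < h (sub_preim (proj N) T))%N.
  apply: leq_ltn_trans (strict (sf_zero F) _ _ _); [by []|exact: sub_le0|].
  move=> le; apply: nz; apply/le_zeroP; apply: sub_le_trans le => x v vN.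
  by rewrite sub_preimE /= (qpi_eq0P _ _ vN) rpred0.
have n0 : (0 < n)%N by apply: leq_trans (gt (sf_zero _)) (bound _).
exists n.-1; first by rewrite prednK.
exists (fun T => (h (sub_preim (proj N) T)).-1); split=> [S T ST TS|T]; last first.
  by rewrite -ltnS !prednK.
rewrite -ltnS !prednK //; apply: strict; first exact: preim_le.
move=> le; apply: TS => x v vT; rewrite -[v]qreprK.
by have := le x (qrepr v); rewrite !sub_preimE /= qreprK; apply.
Qed.

Lemma has_rank_iso F G n : isomorphic F G -> has_rank F n -> has_rank G n.
Proof.
move=> [a [b [ab ba]]]; apply: (has_rank_embed (psi := sub_preim a)).
  by move=> P Q; apply: preim_le.
by move=> P Q le x v; have := le x (b x v); rewrite !sub_preimE ba.
Qed.

Lemma has_rank_subquo F n (P Q : subfunctor F) : has_rank F n -> has_rank (subquo Q P) n.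
Proof.
have sub G (S : subfunctor G) : has_rank G n -> has_rank (sub_functor S) n.
  apply: (has_rank_embed (psi := sf_img (incl S))); first by move=> *; apply: img_le.
  by move=> T U le x v vT; have /le/sf_imgP[w wS /val_inj ->] := mem_img (incl S) vT.
have quo G (S : subfunctor G) : has_rank G n -> has_rank (quo_functor S) n.
  apply: (has_rank_embed (psi := sub_preim (proj S))); first by move=> *; apply: preim_le.
  move=> T U le x v vT; rewrite -[v]qreprK.
  by have := le x (qrepr v); rewrite !sub_preimE /= qreprK; apply.
by move=> rF; apply/quo/sub.
Qed.
End Rank.

(** * Generators of additive functors *)

Section Generators.
Context (C : preadditive) (A : rep C).

Lemma fmap0 x y v : fmap A (0 : hom x y) v = 0.
Proof.
by apply: (@addrI _ (fmap A (0 : hom x y) v)); rewrite -rep_additive !addr0.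
Qed.

Lemma fmapN x y (f : hom x y) v : fmap A (- f) v = - fmap A f v.
Proof. by apply: (@addrI _ (fmap A f v)); rewrite -rep_additive !subrr fmap0. Qed.

Lemma fmapB x y (f g : hom x y) v : fmap A (f - g) v = fmap A f v - fmap A g v.
Proof. by rewrite rep_additive fmapN. Qed.

Lemma fmapMz x y (f : hom x y) v (n : int) : fmap A (f *~ n) v = n *: fmap A f v.
Proof.
have nat (m : nat) : fmap A (f *+ m) v = fmap A f v *+ m.
  by elim: m => [|m IH]; rewrite ?mulr0n ?fmap0 // !mulrS rep_additive IH.
rewrite -[n in RHS]intz scaler_int.
by case: n => m; rewrite ?NegzE ?mulrNz -!pmulrn ?fmapN nat.
Qed.

Section GeneratedSubfunctor.
Context (x : C) (a : A x).
(** Additivity of [A] already makes the values [f a] a subgroup, so no span has to be taken. *)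
Let Z y (v : A y) : Prop := exists f : hom x y, v = fmap A f a.
Let Z0 y : @Z y 0. Proof. by exists 0; rewrite fmap0. Qed.
Let ZD y u v : @Z y u -> Z v -> Z (u + v).
Proof. by move=> [f ->] [g ->]; exists (f + g); rewrite rep_additive. Qed.
Let ZZ y n v : @Z y v -> Z (n *: v).
Proof. by move=> [f ->]; exists (f *~ n); rewrite fmapMz. Qed.
Let Z_stable y z (f : hom y z) v :
  v \in mk_submod (@Z0 y) (@ZD y) (@ZZ y) ->
  fmap A f v \in mk_submod (@Z0 z) (@ZD z) (@ZZ z).
Proof.
by move=> /mk_submodP[g ->]; apply/mk_submodP; exists (comp f g); rewrite fmapM.
Qed.
Definition gen_sub : subfunctor A := SubFunctor Z_stable.
Lemma gen_subP y (v : A y) : v \in gen_sub y <-> exists f : hom x y, v = fmap A f a.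
Proof. by split=> [/mk_submodP|?] //; apply/mk_submodP. Qed.
Lemma mem_gen_sub : a \in gen_sub x.
Proof. by apply/gen_subP; exists (idm x); rewrite fmap1. Qed.
Lemma gen_sub_le (P : subfunctor A) : a \in P x -> sub_le gen_sub P.
Proof. by move=> aP y v /gen_subP[f ->]; apply: sub_stable. Qed.
End GeneratedSubfunctor.

Definition generates x (a : A x) : Prop := forall y (v : A y), exists f : hom x y, v = fmap A f a.

Lemma generatesP x (a : A x) : generates a <-> sub_full (gen_sub a).
Proof. by split=> h y v; have := h y v => /gen_subP. Qed.

(** Hence [proper_part] is spanned by the non-generators, and Q_A has the generators as a basis at
    each object. *)
Lemma not_generates x (a : A x) : ~ generates a <->
  exists P : subfunctor A, ~ sub_full P /\ a \in P x.
Proof.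
split=> [ng|[P [nf aP]] /generatesP g]; last first.
  by apply: nf => y v; apply/(gen_sub_le aP)/g.
by exists (gen_sub a); split; [move/generatesP | apply: mem_gen_sub].
Qed.
End Generators.

(** Take [a] whose generated subfunctor has maximal rank. If some [b] lay outside it, the element of
    a biproduct with components [a] and [b] would generate strictly more. *)
Lemma exists_generator (C : additive_category) (A : rep C) n : has_rank A n ->
  exists x (a : A x), generates a.
Proof.
move=> [h [strict bound]].
pose p m := `[< exists x (a : A x), h (gen_sub a) = m >].
have ex : exists m, p m.
  have [z _] := addcat_zero C.
  by exists (h (gen_sub (0 : A z))); apply/asboolP; exists z, 0.
have bnd m : p m -> (m <= n)%N by move=> /asboolP[x [a <-]].
case: (ex_maxnP ex bnd) => m /asboolP[x [a ha]] max; exists x, a; apply: contrapT => ng.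
have [y [b bn]] : exists y (b : A y), ~ (b \in gen_sub a y).
  apply: contrapT => H; apply: ng; apply/generatesP => y v; apply: contrapT => vn.
  by apply: H; exists y, v.
have [s [i1 [i2 [p1 [p2 [e1 e2 e3 e4 e5]]]]]] := addcat_biproducts x y.
pose c := fmap A i1 a + fmap A i2 b.
have c1 : fmap A p1 c = a by rewrite raddfD /= -!fmapM e1 e4 fmap1 fmap0 addr0.
have c2 : fmap A p2 c = b by rewrite raddfD /= -!fmapM e2 e3 fmap1 fmap0 add0r.
have : (h (gen_sub a) < h (gen_sub c))%N.
  apply: strict; first by apply: gen_sub_le; apply/gen_subP; exists p1.
  by move=> le; apply: bn; apply: le; apply/gen_subP; exists p2.
by rewrite ha ltnNge max //; apply/asboolP; exists s, c.
Qed.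

(** * Killing generators *)

Lemma linear_ext (R : pzRingType) (U V : lmodType R) (f g : {linear U -> V}) :
  f =1 g -> f = g.
Proof.
case: f g => [f [[f1] [f2]]] [g [[g1] [g2]]] /= /funext e; subst g.
by rewrite (Prop_irrelevance f1 g1) (Prop_irrelevance f2 g2).
Qed.

Lemma nt_ext (C : preadditive) (R : pzRingType) (F G : functor C R) (a b : F ~> G) :
  (forall x, a x =1 b x) -> a = b.
Proof.
case: a b => [a an] [b bn] /= ab.
have e : a = b by apply: functional_extensionality_dep => x; exact: linear_ext (ab x).
by subst b; rewrite (Prop_irrelevance an bn).
Qed.

Lemma aut_ext (C : preadditive) (R : pzRingType) (B : functor C R) (g h : aut B) :
  (forall x, g x =1 h x) -> g = h.
Proof.
move=> gh; have e : aut_fwd g = aut_fwd h by apply: nt_ext.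
have e' : aut_bwd g = aut_bwd h.
  apply: nt_ext => x v; rewrite -[v](aut_bwdK h) aut_fwdK.
  by rewrite -gh aut_fwdK.
case: g h e e' {gh} => [a a' k1 k2] [b b' k3 k4] /= e e'; subst b b'.
by rewrite (Prop_irrelevance k1 k3) (Prop_irrelevance k2 k4).
Qed.

Section FreeModules.
Context (k : nzRingType).

Lemma freegUZ (X : choiceType) (c : k) (x : X) :
  << c *g x >> = c *: << x >> :> {freeg X / k}.
Proof. by apply/eqP/freeg_eqP=> y; rewrite coeffZ !coeffU mul1r. Qed.

Lemma freeg_span (X : choiceType) (P : {freeg X / k} -> Prop) :
  P 0 -> (forall u v, P u -> P v -> P (u + v)) -> (forall a v, P v -> P (a *: v)) ->
  (forall x, P << x >>) -> forall D, P D.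
Proof.
move=> P0 PD PZ PU D; rewrite -[D]freeg_sumE; elim/big_ind: _ => // x _.
by rewrite freegUZ; apply/PZ/PU.
Qed.

Lemma free_map_comp (X Y Z : choiceType) (g : Y -> Z) (f : X -> Y) D :
  free_map k g (free_map k f D) = free_map k (g \o f) D.
Proof.
apply: (freeg_ext (f := free_map k g \o free_map k f)) => x.
by rewrite /= !free_mapU.
Qed.

Lemma eq_free_map (X Y : choiceType) (f g : X -> Y) :
  f =1 g -> free_map k f =1 free_map k g.
Proof. by move=> fg; apply: freeg_ext => x; rewrite /= !free_mapU fg. Qed.

Lemma free_map_id (X : choiceType) (D : {freeg X / k}) : free_map k id D = D.
Proof. by apply: (freeg_ext (g := idfun)) => x; rewrite /= free_mapU. Qed.

Lemma free_map_surj (X Y : choiceType) (f : X -> Y) :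
  (forall y, exists x, y = f x) -> forall D, exists E, free_map k f E = D.
Proof.
move=> surj; apply: freeg_span.
- by exists 0; rewrite linear0.
- by move=> _ _ [u <-] [v <-]; exists (u + v); rewrite linearD.
- by move=> a _ [u <-]; exists (a *: u); rewrite linearZ.
- by move=> y; have [x ->] := surj y; exists << x >>; rewrite free_mapU.
Qed.

Lemma coeff_free_map (X Y : choiceType) (f : X -> Y) x (D : {freeg X / k}) :
  injective f -> coeff (f x) (free_map k f D) = coeff x D.
Proof.
move=> f_inj; elim/freeg_span: D.
- by rewrite linear0 !coeff0.
- by move=> u v hu hv; rewrite linearD !coeffD hu hv.
- by move=> a u hu; rewrite linearZ /= !coeffZ hu.
- by move=> y; rewrite free_mapU !coeffU (inj_eq f_inj).
Qed.

Lemma coeff_free_map_neq0 (X Y : choiceType) (f : X -> Y) y (D : {freeg X / k}) :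
  coeff y (free_map k f D) != 0 -> exists2 x, y = f x & coeff x D != 0.
Proof.
move=> nz; apply: contrapT => H; move/eqP: nz; apply.
rewrite -[D]freeg_sumE raddf_sum raddf_sum big_seq big1 // => x.
rewrite mem_dom => xD; rewrite freegUZ /= linearZ /= free_mapU coeffZ coeffU mul1r.
by case: eqP => [e|]; [case: H; exists x|rewrite mulr0].
Qed.
End FreeModules.

Lemma finite_axiom_mem (T : eqType) (e : seq T) : Finite.axiom e -> forall x, x \in e.
Proof. by move=> he x; rewrite -has_pred1 has_count he. Qed.

Lemma finite_axiom_shift (V : zmodType) (e : seq V) (v : V) :
  Finite.axiom e -> perm_eq e [seq u + v | u <- e].
Proof.
move=> he; apply: uniq_perm.
- by apply: count_mem_uniq => x; rewrite he finite_axiom_mem.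
- rewrite map_inj_uniq; last exact: addIr.
  by apply: count_mem_uniq => x; rewrite he finite_axiom_mem.
- move=> x; rewrite finite_axiom_mem //; apply/esym/mapP; exists (x - v).
    exact: finite_axiom_mem.
  by rewrite subrK.
Qed.

Lemma uniq_map_inj (T1 T2 : eqType) (f : T1 -> T2) (s : seq T1) :
  uniq (map f s) -> {in s &, injective f}.
Proof.
move=> u v w vs ws e; rewrite -(nth_index v vs) -(nth_index v ws); congr nth.
apply: (uniqP (f v) u); rewrite ?inE ?size_map ?index_mem //.
by rewrite !(nth_map v) ?index_mem // !nth_index.
Qed.

(** * Finite values and separation of generators *)

Section FiniteValues.
Context (k : fieldType) (C : additive_category) (C_trivial : k_trivial k C).
Context (A : rep C).

(** Evaluation at [a] maps the finite group [hom x y] onto [A y]. *)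
Lemma finite_values x (a : A x) y : generates a -> exists e : seq (A y), forall v, v \in e.
Proof.
move=> ga; have [e he _] := C_trivial x y; exists [seq fmap A f a | f <- e] => v.
by have [f ->] := ga y v; apply/map_f/finite_axiom_mem.
Qed.

Lemma surjective_endo_inj x (a : A x) (phi : A ~> A) : generates a ->
  (forall y w, exists v, phi y v = w) -> forall y v, phi y v = 0 -> v = 0.
Proof.
move=> ga surj y v phiv0; have [e he] := finite_values y ga.
have u : uniq (map (phi y) (undup e)).
  apply: (leq_size_uniq (undup_uniq e)); last by rewrite size_map.
  move=> w _; have [w' <-] := surj y w; apply: map_f; by rewrite mem_undup.
by apply: (uniq_map_inj u); rewrite ?mem_undup // phiv0 linear0.
Qed.

Section Separation.
Context (x : C) (a b : A x).
Hypotheses (ga : generates a) (gb : generates b).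
Hypothesis ab : forall z (h : hom x z), fmap A h b = 0 -> fmap A h a = 0.

Let coef z (v : A z) : hom x z := projT1 (cid (gb v)).
Let coefK z (v : A z) : v = fmap A (coef v) b. Proof. exact: projT2 (cid (gb v)). Qed.
Let phi z (v : A z) : A z := fmap A (coef v) a.
Let phiE z (h : hom x z) : phi (fmap A h b) = fmap A h a.
Proof.
by apply/subr0_eq; rewrite -fmapB ab // fmapB -coefK subrr.
Qed.
Let phi_linear z : linear (@phi z).
Proof.
move=> n u v; rewrite [u]coefK [v]coefK -fmapMz -rep_additive !phiE.
by rewrite rep_additive fmapMz.
Qed.
HB.instance Definition _ z :=
  GRing.isLinear.Build int (A z) (A z) *:%R (@phi z) (@phi_linear z).
Let phi_nat y z (f : hom y z) v :
  (@phi z : {linear _ -> _}) (fmap A f v) = fmap A f ((@phi y : {linear _ -> _}) v).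
Proof. by rewrite [v]coefK -fmapM /= !phiE fmapM. Qed.
Let phi_nt : A ~> A :=
  @NatTrans C int A A (fun z => @phi z : {linear _ -> _}) phi_nat.

(** By [ab], sending [f b] to [f a] is a well defined endomorphism. It is surjective as [a]
    generates, hence bijective on the finite values: one inclusion of annihilators is enough. *)
Lemma generators_same_annihilator : exists g : aut A, a = g x b.
Proof.
have surj y w : exists v, phi_nt y v = w.
  by have [h ->] := ga w; exists (fmap A h b); rewrite /= phiE.
have inj := surjective_endo_inj ga surj.
have [psi [K1 K2]] := bijective_inverse inj surj.
exists (Aut K1 K2) => /=; have := phiE (idm x); by rewrite !fmap1.
Qed.
End Separation.

Lemma generators_separated x (a b : A x) : generates a -> generates b ->
  ~ (exists g : aut A, a = g x b) ->
  exists z (h : hom x z), fmap A h b = 0 /\ fmap A h a <> 0.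
Proof.
move=> ga gb ng; apply: contrapT => H; apply: ng.
apply: generators_same_annihilator => // z h hb; apply: contrapT => ha.
by apply: H; exists z, h.
Qed.

(* The sum over [f] of the translations by [f t] factors through [k[A/N]], where
   [N] is the subfunctor generated by [t]. *)
Lemma common_kernel_translates y z (t : A z) (e : seq (hom z y)) q :
  t <> 0 -> Finite.axiom e -> q \in common_kernel k A y ->
  \sum_(f <- e) free_map k (fun b => b + fmap A f t) q = 0.
Proof.
move=> t0 he /common_kernelP/(_ (gen_sub t)) qK.
pose rho (c : quo_functor (gen_sub t) y) : klin k A y :=
  \sum_(f <- e) << qrepr c + fmap A f t >>.
pose pr := klin_nt k (proj (gen_sub t)) y.
have E D : \sum_(f <- e) free_map k (fun b => b + fmap A f t) D = fglift rho (pr D).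
  elim/freeg_span: D.
  - by rewrite !linear0 big1 // => f _; rewrite linear0.
  - move=> u v hu hv; rewrite [RHS](linearD (fglift rho \o pr)) /= -hu -hv -big_split /=.
    by apply: eq_bigr => f _; rewrite linearD.
  - move=> c u hu; rewrite [RHS](linearZ_LR (fglift rho \o pr)) /= -hu scaler_sumr.
    by apply: eq_bigr => f _; rewrite linearZ.
  - move=> b; rewrite /= free_mapU fgliftU /rho.
    (* [b] differs from the representative of its class by some [f0 t]; replacing one by the other
       shifts the summation index by [f0]. *)
    have : b - qrepr (qpi (gen_sub t y) b) \in gen_sub t y.
      by apply/qpiP; rewrite qreprK.
    case/gen_subP=> f0 e0.
    rewrite [RHS](perm_big _ (finite_axiom_shift f0 he)) big_map /=.
    apply: eq_bigr => f _; rewrite free_mapU rep_additive -e0.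
    by congr << _ >>; rewrite [RHS]addrCA subrKC addrC.
rewrite E qK ?linear0 // => z0; apply: t0; exact: z0 (mem_gen_sub t).
Qed.

(** Start from any lift [u] of [q] along evaluation at [a]. For each [b] in [l], subtract from [u]
    the average of its translates by the [f h]. This makes the value at [b] zero, keeps the value
    [q] at [a] because [q] lies in Q^A and [h a] is nonzero, and keeps the zeros already
    obtained. *)
Lemma separating_element x y (a : A x) (l : seq (A x)) (q : klin k A y) :
  generates a -> q \in common_kernel k A y ->
  (forall b, b \in l -> exists z (h : hom x z), fmap A h b = 0 /\ fmap A h a <> 0) ->
  exists u : {freeg (hom x y) / k}, free_map k (fun f => fmap A f a) u = q /\
    forall b, b \in l -> free_map k (fun f => fmap A f b) u = 0.
Proof.
move=> ga qK; elim: l => [|b l IH] hl.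
  have surj (v : A y) : exists f, v = fmap A f a by apply: ga.
  by have [u uE] := free_map_surj surj q; exists u.
have [|u [ua ul]] := IH; first by move=> b' b'l; apply: hl; rewrite inE b'l orbT.
have [z [h [hb ha]]] := hl b (mem_head b l).
have [e he c_unit] := C_trivial z y; set c := (size e)%:R in c_unit.
pose tau f := free_map k (fun g : hom x y => g + comp f h).
have tauE f (d : A x) : free_map k (fun g => fmap A g d) (tau f u) =
    free_map k (fun v => v + fmap A f (fmap A h d)) (free_map k (fun g => fmap A g d) u).
  by rewrite !free_map_comp; apply: eq_free_map => g /=; rewrite rep_additive fmapM.
have sumE (d : A x) : free_map k (fun g => fmap A g d) (u - c^-1 *: \sum_(f <- e) tau f u) =
    free_map k (fun g => fmap A g d) u - c^-1 *: \sum_(f <- e)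
     free_map k (fun v => v + fmap A f (fmap A h d)) (free_map k (fun g => fmap A g d) u).
  rewrite linearB; congr (_ - _); rewrite linearZ; congr (_ *: _).
  rewrite linear_sum /=.
  by apply: eq_bigr => f _; apply: tauE.
exists (u - c^-1 *: \sum_(f <- e) tau f u); split.
  by rewrite sumE ua (common_kernel_translates ha he qK) scaler0 subr0.
move=> d; rewrite inE => /orP[/eqP->|dl]; last first.
  by rewrite sumE ul // big1 ?scaler0 ?subr0 // => f _; rewrite linear0.
rewrite sumE; set w := free_map _ _ u.
(* As [h b = 0], all translates of [u] have the same value [w] at [b], so their average is [w]; the
   division by the order of [hom z y] is allowed by k-triviality. *)
rewrite (eq_bigr (fun=> w)) => [|f _]; last first.
  rewrite -[RHS]free_map_id; apply: eq_free_map => v.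
  by rewrite hb linear0 addr0.
by rewrite big_const_seq count_predT iter_addr_0 -scaler_nat scalerA mulVr // scale1r subrr.
Qed.
End FiniteValues.

(** * Coinvariants of tensor products with Q_B *)

Section Lifting.
Context (R : pzRingType) (V W : lmodType R) (f : {linear V -> W}).

Section Kernel.
Let P (v : V) : Prop := f v = 0.
Let P0 : P 0. Proof. by rewrite /P linear0. Qed.
Let PD u v : P u -> P v -> P (u + v).
Proof. by rewrite /P linearD => -> ->; rewrite addr0. Qed.
Let PZ a v : P v -> P (a *: v).
Proof. by rewrite /P linearZ_LR => ->; rewrite scaler0. Qed.
Definition ker_submod : submodClosed V := mk_submod P0 PD PZ.
Lemma ker_submodP v : v \in ker_submod <-> f v = 0.
Proof. by split=> [/mk_submodP|?] //; apply/mk_submodP. Qed.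
End Kernel.

Lemma span_kill (X : V -> Prop) :
  (forall u, X u -> f u = 0) -> forall v, v \in span_of X -> f v = 0.
Proof. by move=> Xf v /span_ofP h; apply/ker_submodP/h => u /Xf/ker_submodP. Qed.

Section Quotient.
Context (S : submodClosed V).
Hypothesis fS : forall v, v \in S -> f v = 0.
Let g (q : quomod S) : W := f (qrepr q).
Let gE v : g (qpi S v) = f v.
Proof. by apply/subr0_eq; rewrite -linearB; apply/fS/qpiP; rewrite qreprK. Qed.
Let g_linear : linear g.
Proof. by move=> a u v; rewrite -[u]qreprK -[v]qreprK -linearP !gE linearP. Qed.
HB.instance Definition _ := GRing.isLinear.Build R (quomod S) W *:%R g g_linear.

Lemma quomod_lift : exists h : {linear quomod S -> W}, forall v, h (qpi S v) = f v.
Proof. by exists g. Qed.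
End Quotient.
End Lifting.

Section TensorLift.
Context (k : fieldType) (M V W : lmodType k) (beta : M -> {linear V -> W}).
Hypothesis beta_linear : forall a m m' v, beta (a *: m + m') v = a *: beta m v + beta m' v.

Lemma tensor_lift : exists h : {linear tensor M V -> W}, forall m v, h (tens m v) = beta m v.
Proof.
pose f : {linear {freeg (M * V)%type / k} -> W} := fglift (fun p : M * V => beta p.1 p.2).
have fU m v : f << (m, v) >> = beta m v by rewrite /= fgliftU.
have bD m m' v : beta (m + m') v = beta m v + beta m' v.
  by rewrite -[m]scale1r beta_linear !scale1r.
have b0 v : beta 0 v = 0 by apply: (@addrI _ (beta 0 v)); rewrite -bD !addr0.
have bZ a m v : beta (a *: m) v = a *: beta m v.
  by rewrite -[a *: m]addr0 beta_linear b0 addr0.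
have fR v : v \in span_of (@bilinear_relator k M V) -> f v = 0.
  apply: span_kill => {}v [m m' w|m w w'|a m w|a m w].
  - by rewrite (linearB f) (linearD f) !fU bD subrr.
  - by rewrite (linearB f) (linearD f) !fU linearD subrr.
  - by rewrite (linearB f) (linearZ_LR f) !fU bZ subrr.
  - by rewrite (linearB f) (linearZ_LR f) !fU linearZ_LR subrr.
have [h hE] := quomod_lift fR; exists h => m v; by rewrite hE fU.
Qed.
End TensorLift.

Lemma nt_compE (C : preadditive) (R : pzRingType) (F G H : functor C R)
  (b : G ~> H) (a : F ~> G) x v : nt_comp b a x v = b x (a x v).
Proof. by []. Qed.

Section CoinvariantInduction.
Context (k : fieldType) (C : preadditive) (R : pzRingType) (B : functor C R).
Context (M : aut_module k B) (F : aut_functor k B).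

Arguments coinv_tensor : simpl never.
Definition coten y (m : M) (v : F y) : coinv_tensor M F y :=
  qpi (moved_part M F y) (tens m v).

Lemma coten_ind y (P : coinv_tensor M F y -> Prop) :
  P 0 -> (forall u v, P u -> P v -> P (u + v)) -> (forall a v, P v -> P (a *: v)) ->
  (forall m v, P (coten m v)) -> forall v, P v.
Proof.
move=> P0 PD PZ PU v; rewrite -[v]qreprK; move: (qrepr v) => t.
rewrite -[t]qreprK; move: (qrepr t) => D.
pose pi : {linear {freeg (M * F y)%type / k} -> coinv_tensor M F y} :=
   qpi (moved_part M F y) \o qpi (span_of (@bilinear_relator k M (F y))).
rewrite -[X in P X]/(pi D); elim/freeg_span: D.
- by rewrite linear0.
- by move=> a b ? ?; rewrite linearD; apply: PD.
- by move=> a b ?; rewrite linearZ; apply: PZ.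
- by case=> m w; apply: PU.
Qed.

Lemma cotenDl y m m' (v : F y) : coten (m + m') v = coten m v + coten m' v.
Proof. by rewrite /coten tensDl linearD. Qed.
Lemma cotenDr y m (v v' : F y) : coten m (v + v') = coten m v + coten m v'.
Proof. by rewrite /coten tensDr linearD. Qed.
Lemma cotenZl y a m (v : F y) : coten (a *: m) v = a *: coten m v.
Proof. by rewrite /coten tensZl linearZ. Qed.
Lemma cotenZr y a m (v : F y) : coten m (a *: v) = a *: coten m v.
Proof. by rewrite /coten tensZr linearZ. Qed.
Lemma coten_aut y g m (v : F y) : coten (am_act M g m) (af_act F g y v) = coten m v.
Proof.
apply/qpiP/sub_span_of; exists g, (tens m v); congr (_ - _).
by apply/esym; apply: tens_mapE.
Qed.
Lemma coten_nat y z (f : hom y z) m (v : F y) :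
  fmap (coinv_tensor M F) f (coten m v) = coten m (fmap F f v).
Proof.
transitivity (qpi (moved_part M F z) (fmap (tensor_functor M F) f (tens m v))).
  exact: quomod_mapE.
congr (qpi _ _); exact: tens_mapE.
Qed.

Lemma coinv_tensor_ntE (G : aut_functor k B) (a : F ~> G)
    (aE : forall g x v, a x (af_act F g x v) = af_act G g x (a x v)) y m (v : F y) :
  coinv_tensor_nt M aE y (coten m v) =
  qpi (moved_part M G y) (tens m (a y v)).
Proof.
transitivity (qpi (moved_part M G y) (tensor_nt (idfun : {linear M -> M}) a y (tens m v))).
  exact: quomod_mapE.
congr (qpi _ _); exact: tens_mapE.
Qed.
End CoinvariantInduction.


Section LowerTensor.
Context (k : fieldType) (C : additive_category) (B : rep C) (M : aut_module k B).

Definition Xtensor : functor C k := coinv_tensor M (Q_lower_aut k B).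

Arguments Xtensor : simpl never.
Definition cten y (m : M) (w : klin k B y) : Xtensor y :=
  @coten k C int B M (Q_lower_aut k B) y m (qpi (proper_part k B y) w).

Fact cten_linear y m : linear (@cten y m).
Proof. by move=> a u v; rewrite /cten linearP cotenDr cotenZr. Qed.
HB.instance Definition _ y m :=
  GRing.isLinear.Build k (klin k B y) (Xtensor y) *:%R (@cten y m) (@cten_linear y m).

Lemma ctenDl y m m' (w : klin k B y) : cten (m + m') w = cten m w + cten m' w.
Proof. exact: cotenDl. Qed.
Lemma ctenZl y a m (w : klin k B y) : cten (a *: m) w = a *: cten m w.
Proof. exact: cotenZl. Qed.
Lemma cten_aut y g m (w : klin k B y) : cten (am_act M g m) (klin_nt k g y w) = cten m w.
Proof.
rewrite -[RHS](coten_aut g); congr coten; apply/esym; exact: quomod_mapE.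
Qed.
Lemma cten_nat y z (f : hom y z) m (w : klin k B y) :
  fmap Xtensor f (cten m w) = cten m (fmap (klin k B) f w).
Proof. rewrite [LHS]coten_nat; congr coten; exact: quomod_mapE. Qed.

Lemma cten_nongenerator y m (b : B y) : ~ generates b -> cten m << b >> = 0.
Proof.
move=> /not_generates[P [nf bP]].
have pb : << b >> \in proper_part k B y.
  apply: sub_span_of; exists P; split=> //; exists << (SubModule bP) >>.
  by rewrite /= free_mapU.
rewrite /cten (qpi_eq0P _ _ pb).
by rewrite -(scale0r 0) cotenZr scale0r.
Qed.

Lemma cten_ind y (P : Xtensor y -> Prop) :
  P 0 -> (forall u v, P u -> P v -> P (u + v)) ->
  (forall m b, P (cten m << b >>)) -> forall v, P v.
Proof.
move=> P0 PD PU v.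
(* Generalizing over a scalar replaces a scaling hypothesis on [P]: at the end the scalar is
   absorbed into [m]. *)
suff: forall a, P (a *: v) by move/(_ 1); rewrite scale1r.
elim/coten_ind: v.
- by move=> a; rewrite scaler0.
- by move=> u v hu hv a; rewrite scalerDr; apply: PD.
- by move=> a v hv b; rewrite scalerA.
move=> m q; rewrite -[q]qreprK; move: (qrepr q) => w.
rewrite -[coten _ _]/(cten m w).
elim/freeg_span: w.
- by move=> a; rewrite linear0 scaler0.
- by move=> u w hu hw a; rewrite linearD scalerDr; apply: PD.
- by move=> a w hw b; rewrite linearZ_LR scalerA.
- by move=> b a; rewrite -ctenZl.
Qed.

Section Lift.
Context (y : C) (W : lmodType k) (beta : M -> B y -> W).
Hypothesis beta_linear : forall a m m' b, beta (a *: m + m') b = a *: beta m b + beta m' b.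
Hypothesis beta_ng : forall m b, ~ generates b -> beta m b = 0.
Hypothesis beta_aut : forall g m b, beta (am_act M g m) (g y b) = beta m b.

(** Extend each [beta m] linearly to [k[B]]. Vanishing on non-generators lets it descend to Q_B,
    linearity in [m] gives a map on the tensor product, and invariance lets that map descend to the
    coinvariants. *)
Lemma cten_lift : exists h : {linear Xtensor y -> W}, forall m b, h (cten m << b >>) = beta m b.
Proof.
pose L m : {linear {freeg (B y) / k} -> W} := fglift (beta m).
have LU m b : L m << b >> = beta m b by apply: fgliftU.
have LP m w : w \in proper_part k B y -> L m w = 0.
  apply: span_kill => {}w [P [nf [u ->]]]; elim/freeg_span: u.
  - by rewrite linear0 (linear0 (L m)).
  - move=> u v hu hv; rewrite (linearD (klin_nt k (incl P) y)).
    by rewrite (linearD (L m)) hu hv addr0.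
  - move=> a u hu; rewrite (linearZ_LR (klin_nt k (incl P) y)).
    by rewrite (linearZ_LR (L m)) hu scaler0.
  - case=> b bP; rewrite [klin_nt _ _ _ _]free_mapU LU beta_ng //.
    by apply/not_generates; exists P.
pose l m : {linear Q_lower k B y -> W} := projT1 (cid (quomod_lift (@LP m))).
have lE m w : l m (qpi (proper_part k B y) w) = L m w by apply: (projT2 (cid (quomod_lift (@LP m)))).
have lb a m m' q : l (a *: m + m') q = a *: l m q + l m' q.
  rewrite -[q]qreprK !lE; move: (qrepr q) => w; elim/freeg_span: w.
  - by rewrite !(linear0 (L _)) scaler0 addr0.
  - by move=> u v hu hv; rewrite !(linearD (L _)) hu hv scalerDr addrACA.
  - move=> c u hu; rewrite !(linearZ_LR (L _)) hu scalerDr !scalerA.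
    by rewrite [c * a]mulrC.
  - by move=> b; rewrite !LU.
have [h hE] := tensor_lift lb.
have hM t : t \in moved_part M (Q_lower_aut k B) y -> h t = 0.
  apply: span_kill => {}t [g [t' ->]]; rewrite linearB; apply/eqP; rewrite subr_eq0; apply/eqP.
  apply: (tensor_ext (f := h \o tens_map (am_act M g) (af_act (Q_lower_aut k B) g y))) => m q.
  rewrite -[q]qreprK; move: (qrepr q) => w.
  rewrite [LHS](congr1 h (tens_mapE _ _ _ _)) !hE.
  rewrite [X in l _ X](_ : _ = qpi (proper_part k B y) (klin_nt k g y w)); last exact: quomod_mapE.
  rewrite !lE.
  apply: (freeg_ext (f := L (am_act M g m) \o klin_nt k g y)) => b.
  by rewrite /= free_mapU !LU beta_aut.
have [h' hE'] := quomod_lift hM; exists h' => m b.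
by rewrite [h' _]hE' hE lE LU.
Qed.
End Lift.

Let cmu_nat m y z (f : hom y z) w :
  cten m (fmap (klin k B) f w) = fmap Xtensor f (cten m w).
Proof. by rewrite cten_nat. Qed.
Definition cmu m : klin k B ~> Xtensor := NatTrans (cmu_nat m).

Definition cQsub : subfunctor Xtensor := sub_im (Qmap M).

(** Consequently Q(B, M) is spanned by the classes of [m (x) q] with [q] in Q^B. *)
Lemma Qmap_coten y m (q : Q_upper k B y) :
  Qmap M y (coten (F := Q_upper_aut k B) m q) = cten m (val q).
Proof.
by rewrite /Qmap nt_compE !coinv_tensor_ntE.
Qed.

Lemma cten_Qsub y m q : q \in common_kernel k B y -> cten m q \in cQsub y.
Proof.
move=> qK; apply/submod_imP; exists (coten (F := Q_upper_aut k B) m (SubModule qK)).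
by rewrite Qmap_coten.
Qed.

Lemma cQsub_le (G : subfunctor Xtensor) :
  (forall y m q, q \in common_kernel k B y -> cten m q \in G y) -> sub_le cQsub G.
Proof.
move=> h y v /submod_imP[t ->]; elim/coten_ind: t.
- by rewrite linear0 rpred0.
- by move=> a b ? ?; rewrite linearD rpredD.
- by move=> a b ?; rewrite linearZ rpredZ.
- by move=> m q; rewrite Qmap_coten; apply/h/valP.
Qed.
End LowerTensor.

(** * Universal property of the coinvariants *)

Section TensorUniversal.
Context (k : fieldType) (C : additive_category) (B : rep C).

(* The tensor functors are only used through their universal property: keeping
   them abstract prevents the unifier from unfolding the quotients involved. *)
Record lower_tensor_data (M : aut_module k B) := LowerTensor {
  lt_functor :> functor C k;
  lt_mu : M -> klin k B ~> lt_functor;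
  lt_muP : forall y a m m' w,
    lt_mu (a *: m + m') y w = a *: lt_mu m y w + lt_mu m' y w;
  lt_mu_aut : forall y g m w,
    lt_mu (am_act M g m) y (klin_nt k g y w) = lt_mu m y w;
  lt_mu_nongenerator : forall y m (b : B y), ~ generates b -> lt_mu m y << b >> = 0;
  lt_mu_ind : forall y (P : lt_functor y -> Prop),
    P 0 -> (forall u v, P u -> P v -> P (u + v)) ->
    (forall m (b : B y), P (lt_mu m y << b >>)) -> forall v, P v;
  lt_mu_lift : forall y (W : lmodType k) (beta : M -> B y -> W),
    (forall a m m' b, beta (a *: m + m') b = a *: beta m b + beta m' b) ->
    (forall m b, ~ generates b -> beta m b = 0) ->
    (forall g m b, beta (am_act M g m) (g y b) = beta m b) ->
    exists h : {linear lt_functor y -> W}, forall m b, h (lt_mu m y << b >>) = beta m b;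
  lt_Qsub : subfunctor lt_functor;
  lt_Qfunctor : isomorphic (Qfunctor M) (sub_functor lt_Qsub);
  lt_mem_Qsub : forall y m q, q \in common_kernel k B y -> lt_mu m y q \in lt_Qsub y;
  lt_Qsub_le : forall G : subfunctor lt_functor,
    (forall y m q, q \in common_kernel k B y -> lt_mu m y q \in G y) ->
    sub_le lt_Qsub G
}.

Lemma lower_tensor (M : aut_module k B) : lower_tensor_data M.
Proof.
apply: (@LowerTensor M (Xtensor M) (@cmu k C B M) _ _ _ _ _ (cQsub M)).
- by move=> y a m m' w; rewrite [LHS]ctenDl ctenZl.
- by move=> y g m w; apply: cten_aut.
- by move=> y m b; apply: cten_nongenerator.
- by move=> y P; apply: cten_ind.
- by move=> y W beta; apply: cten_lift.
- exact: isomorphic_refl.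
- by move=> y m q; apply: cten_Qsub.
- by move=> G; apply: cQsub_le.
Qed.
End TensorUniversal.

Notation ten m w := (lt_mu (lower_tensor _) m _ w).

Section TenTheory.
Context (k : fieldType) (C : additive_category) (B : rep C) (M : aut_module k B).
Local Notation X := (lower_tensor M).

Lemma tenDl y (m m' : M) (w : klin k B y) : ten (m + m') w = ten m w + ten m' w.
Proof. by rewrite -[m]scale1r lt_muP !scale1r. Qed.
Lemma ten0l y (w : klin k B y) : ten (0 : M) w = 0.
Proof. by apply: (@addrI _ (ten (0 : M) w)); rewrite -tenDl !addr0. Qed.
Lemma tenZl y a (m : M) (w : klin k B y) : ten (a *: m) w = a *: ten m w.
Proof. by rewrite -[a *: m]addr0 lt_muP ten0l addr0. Qed.
Lemma tenBl y (m m' : M) (w : klin k B y) : ten (m - m') w = ten m w - ten m' w.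
Proof. by apply/eqP; rewrite eq_sym subr_eq -tenDl subrK. Qed.
Lemma ten_nat y z (f : hom y z) (m : M) (w : klin k B y) :
  fmap X f (ten m w) = ten m (fmap (klin k B) f w).
Proof. by rewrite ntm_nat. Qed.

Lemma ten_sum y (v : X y) :
  exists l : seq (M * B y), v = \sum_(p <- l) ten p.1 << p.2 >>.
Proof.
elim/lt_mu_ind: v.
- by exists [::]; rewrite big_nil.
- by move=> _ _ [l1 ->] [l2 ->]; exists (l1 ++ l2); rewrite big_cat.
- by move=> m b; exists [:: (m, b)]; rewrite big_seq1.
Qed.

Lemma ten_ext y (W : lmodType k) (f g : {linear X y -> W}) :
  (forall (m : M) (b : B y), f (ten m << b >>) = g (ten m << b >>)) -> f =1 g.
Proof.
move=> fg; apply: lt_mu_ind => //; first by rewrite !linear0.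
by move=> u v hu hv; rewrite !linearD hu hv.
Qed.

Lemma ten_lift_nt (G : functor C k) (beta : forall y, M -> B y -> G y) :
  (forall y a m m' b, beta y (a *: m + m') b = a *: beta y m b + beta y m' b) ->
  (forall y m b, ~ generates b -> beta y m b = 0) ->
  (forall y g m b, beta y (am_act M g m) (g y b) = beta y m b) ->
  (forall y z (f : hom y z) m b, fmap G f (beta y m b) = beta z m (fmap B f b)) ->
  exists h : X ~> G, forall y (m : M) (b : B y), h y (ten m << b >>) = beta y m b.
Proof.
move=> bl bn ba bnat.
pose h y : {linear X y -> G y} := projT1 (cid (@lt_mu_lift _ _ _ _ X _ _ _ (@bl y) (@bn y) (@ba y))).
have hE y (m : M) (b : B y) : h y (ten m << b >>) = beta y m b.
  exact: (projT2 (cid (@lt_mu_lift _ _ _ _ X _ _ _ (@bl y) (@bn y) (@ba y)))).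
have hn y z (f : hom y z) v : h z (fmap X f v) = fmap G f (h y v).
  apply: (ten_ext (f := h z \o fmap X f) (g := fmap G f \o h y)) => m b.
  rewrite /= ten_nat hE bnat -hE; congr (h z (ten m _)); exact: free_mapU.
by exists (NatTrans hn).
Qed.
End TenTheory.

(** * Simplicity and nonvanishing *)

Section AutGenerators.
Context (C : preadditive) (B : rep C).

Lemma generates_aut x (b : B x) (g : aut B) : generates b -> generates (g x b).
Proof.
move=> gb y v; have [f e] := gb y (aut_bwd g y v); exists f.
by rewrite -ntm_nat -e aut_bwdK.
Qed.

(** This is the freeness of the action of Aut(B) on generators, on which the well-definedness of
    coefficients rests. *)
Lemma aut_generator_inj x (b : B x) (g h : aut B) : generates b -> g x b = h x b -> g = h.
Proof.
by move=> gb e; apply: aut_ext => y v; have [f ->] := gb y v; rewrite !ntm_nat e.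
Qed.
End AutGenerators.

Section Simplicity.
Context (k : fieldType) (C : additive_category) (C_trivial : k_trivial k C).
Context (B : rep C) (M : aut_module k B).
Local Notation X := (lower_tensor M).

(** In the coinvariants [m (x) [c] = g m (x) [g c]], so all terms whose generator lies in the orbit
    of [b] merge into one. *)
Lemma ten_orbit_sum y (b : B y) (l : seq (M * B y)) :
  exists m : M, \sum_(p <- l | `[< exists g : aut B, b = g y p.2 >]) ten p.1 << p.2 >> = ten m << b >> :> X y.
Proof.
elim/big_ind: _ => [|_ _ [m ->] [m' ->]|[m c] /asboolP[g ->]].
- by exists 0; rewrite ten0l.
- by exists (m + m'); rewrite tenDl.
- by exists (am_act M g m); rewrite -(lt_mu_aut X g) /= free_mapU.
Qed.

(** Discard the non-generators and gather the orbit of the first remaining one. If the gathered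
    coefficient vanishes, start again with fewer terms. *)
Lemma ten_normal_form y (v : X y) : v <> 0 ->
  exists (m : M) (b : B y) (l : seq (M * B y)),
    [/\ v = ten m << b >> + \sum_(p <- l) ten p.1 << p.2 >>, m <> 0, generates b
      & forall p, p \in l -> generates p.2 /\ ~ exists g : aut B, b = g y p.2].
Proof.
have [l ->] := ten_sum v.
have -> : \sum_(p <- l) ten p.1 << p.2 >> =
    \sum_(p <- [seq p <- l | `[< generates p.2 >]]) ten p.1 << p.2 >> :> X y.
  rewrite big_filter [LHS](bigID (fun p : M * B y => `[< generates p.2 >])) /=.
  rewrite [X in _ + X]big1 ?addr0 // => p /asboolP; exact: lt_mu_nongenerator.
have : forall p, p \in [seq p <- l | `[< generates p.2 >]] -> generates p.2.
  by move=> p; rewrite mem_filter => /andP[/asboolP].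
move: [seq _ <- _ | _] => {}l; have [n] := ubnP (size l).
elim: n l => // n IH [|[m b] l] lt gl; first by rewrite big_nil.
pose orb (p : M * B y) := `[< exists g : aut B, b = g y p.2 >].
have [m' e] := ten_orbit_sum b l.
have {}e : \sum_(p <- (m, b) :: l) ten p.1 << p.2 >> =
    ten (m + m') << b >> + \sum_(p <- [seq p <- l | ~~ orb p]) ten p.1 << p.2 >> :> X y.
  by rewrite big_cons big_filter (bigID orb) /= e addrA tenDl.
have gl' p : p \in [seq p <- l | ~~ orb p] -> generates p.2.
  by rewrite mem_filter => /andP[_ pl]; apply: gl; rewrite inE pl orbT.
rewrite e; have [->|/eqP m0] := eqVneq (m + m') 0.
  rewrite ten0l add0r; apply: IH => //; rewrite size_filter.
  exact: leq_ltn_trans (count_size _ _) _.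
move=> _; exists (m + m'), b, [seq p <- l | ~~ orb p]; split=> //.
  by apply: (gl (m, b)); rewrite mem_head.
by move=> p pl; split; [apply: gl'|move: pl; rewrite mem_filter => /andP[/asboolP]].
Qed.

(* Acting on [v = m (x) b + ...] by a linear combination of morphisms which sends
   [b] to [q] and kills the other generators occurring in [v]. *)
Lemma subfunctor_contains (G : subfunctor X) y (v : X y) : v \in G y -> v <> 0 ->
  exists2 m : M, m <> 0 & forall z q, q \in common_kernel k B z -> ten m q \in G z.
Proof.
move=> vG /ten_normal_form[m [b [l [ev m0 gb hl]]]]; exists m => // z q qK.
have [|u [ub ul]] := @separating_element k C C_trivial B y z b [seq p.2 | p <- l] q gb qK.
  by move=> _ /mapP[p /hl[gp np] ->]; apply: (generators_separated C_trivial).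
pose act w : {linear {freeg (hom y z) / k} -> X z} := fglift (fun f : hom y z => fmap X f w).
have actU w f : act w << f >> = fmap X f w by apply: fgliftU.
have act_ten (m' : M) c D : act (ten m' << c >>) D = ten m' (free_map k (fun f => fmap B f c) D).
  apply: (freeg_ext (f := act (ten m' << c >>))
     (g := lt_mu X m' z \o free_map k (fun f : hom y z => fmap B f c))) => f.
  by rewrite actU [RHS]/= free_mapU ten_nat; congr (ten m' _); apply: free_mapU.
have actD w w' D : act (w + w') D = act w D + act w' D.
  elim/freeg_span: D; first by rewrite !linear0 addr0.
  - by move=> D E hD hE; rewrite !(linearD (act _)) hD hE addrACA.
  - by move=> c D hD; rewrite !(linearZ_LR (act _)) hD -scalerDr.
  - by move=> f; rewrite !actU linearD.
have act0 D : act 0 D = 0 by apply: (@addrI _ (act 0 D)); rewrite -actD !addr0.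
suff <- : act v u = ten m q.
  elim/freeg_span: u {ub ul} => [|D E hD hE|c D hD|f].
  - by rewrite linear0 rpred0.
  - by rewrite linearD rpredD.
  - by rewrite linearZ rpredZ.
  - by rewrite actU sub_stable.
rewrite ev actD act_ten ub (_ : act _ u = 0) ?addr0 //.
rewrite (big_morph (act^~ u) (id1 := 0) (op1 := +%R)) //.
rewrite big_seq; apply: big1 => p pl; rewrite act_ten ul ?linear0 //.
exact: map_f.
Qed.

(** The [m] such that [m (x) q] lies in [G] for all [q] in Q^B form a stable submodule, nonzero by
    [subfunctor_contains], hence equal to [M]. *)
Lemma Qsub_minimal (G : subfunctor X) : simple_module M -> ~ sub_zero G -> sub_le (lt_Qsub X) G.
Proof.
move=> [_ simp] /not_zeroP[y [v vG /(subfunctor_contains vG)[m m0 hm]]].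
pose P (m : M) := forall z q, q \in common_kernel k B z -> ten m q \in G z.
have P0 : P 0 by move=> z q _; rewrite ten0l rpred0.
have PD m1 m2 : P m1 -> P m2 -> P (m1 + m2).
  by move=> h1 h2 z q qK; rewrite tenDl rpredD ?h1 ?h2.
have PZ a m1 : P m1 -> P (a *: m1) by move=> h1 z q qK; rewrite tenZl rpredZ ?h1.
case: (simp (mk_submod P0 PD PZ)).
- move=> g m1 /mk_submodP h1; apply/mk_submodP => z q qK.
  (* [g m (x) q = m (x) g^-1 q], and Q^B is stable under [g^-1]. *)
  rewrite -(lt_mu_aut X (aut_inv g)) -am_actM.
  have -> : aut_mul (aut_inv g) g = aut_one B by apply: aut_ext => x w /=; rewrite aut_fwdK.
  rewrite am_act1; apply: h1.
  exact: valP (af_act (Q_upper_aut k B) (aut_inv g) z (SubModule qK)).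
- by move=> h; case: m0; apply: h; apply/mk_submodP.
- move=> h; apply: lt_Qsub_le => z m1 q qK.
  by have /mk_submodP := h m1; apply.
Qed.

End Simplicity.

(** * Nonvanishing of Q(B, M) *)

Section NonVanishing.
Context (k : fieldType) (C : additive_category) (B : rep C).

(* The tensor product of [a] with differences [0 - n], with one nonzero [n] in
   each of the given subfunctors. *)
Lemma kernel_element x (a : B x) (s : seq nat) (L : nat -> subfunctor B) : generates a ->
  exists y (b : B y) (w : klin k B y) (p : hom y x),
  [/\ generates (fmap B p b), coeff b w = 1,
      forall c, coeff c w != 0 -> fmap B p c = fmap B p b
    & forall j, j \in s -> ~ sub_zero (L j) -> klin_nt k (proj (L j)) y w = 0].
Proof.
move=> ga; elim: s => [|j s [y [b [w [p [gb wb wc ws]]]]]].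
  exists x, a, << a >>, (idm x); split; rewrite ?fmap1 // ?coeffU ?eqxx ?mulr1 //.
  by move=> c; rewrite coeffU mul1r fmap1; have [->|_] := eqVneq a c; rewrite ?fmap1 ?eqxx.
have [z0|/not_zeroP[z [n nL n0]]] := pselect (sub_zero (L j)).
  exists y, b, w, p; split=> // i; rewrite inE => /orP[/eqP->|/ws] //.
have [t [i1 [i2 [p1 [p2 [e1 e2 e3 e4 e5]]]]]] := addcat_biproducts y z.
(* The new factor [0 - n] turns [w] into [w1 - w2]: [w] with second component zero, minus [w] with
   second component [n]. *)
pose tau c := fmap B i1 c + fmap B i2 n.
have i1K : cancel (fmap B i1) (fmap B p1) by move=> c; rewrite -fmapM e1 fmap1.
have tauK c : fmap B p1 (tau c) = c.
  by rewrite linearD i1K /= -fmapM e4 fmap0 addr0.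
pose w1 := free_map k (fmap B i1) w; pose w2 := free_map k tau w.
exists t, (fmap B i1 b), (w1 - w2), (comp p p1); split.
- by rewrite fmapM i1K.
- rewrite coeffB coeff_free_map ?wb; last exact: can_inj i1K.
  (* All elements of the support of [w2] have the nonzero second component [n], unlike the image of
     [b]. *)
  suff -> : coeff (fmap B i1 b) w2 = 0 by rewrite subr0.
  apply: contrapT => /eqP/coeff_free_map_neq0[c e _]; apply: n0.
  have /(congr1 (fmap B p2)) := e; rewrite linearD /= -!fmapM e3 e2 !fmap0 fmap1 add0r.
  by move=> ->.
- move=> c; rewrite coeffB => nz; rewrite !fmapM i1K.
  have [z1|/coeff_free_map_neq0[d -> /wc]] := eqVneq (coeff c w1) 0; last by rewrite i1K.
  move: nz; rewrite z1 sub0r oppr_eq0 => /coeff_free_map_neq0[d -> /wc].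
  by rewrite tauK.
(* Modulo [L j], which contains [n], the terms of [w1] and [w2] agree. For the earlier subfunctors,
   both images are computed from that of [w], which is zero. *)
move=> i; rewrite inE => /orP[/eqP->|/ws h] nz; rewrite linearB.
  rewrite /= !free_map_comp; apply/eqP; rewrite subr_eq0; apply/eqP/eq_free_map => c /=.
  by apply/qpiP; rewrite opprD addNKr -scaleN1r rpredZ ?sub_stable.
have -> : klin_nt k (proj (L i)) t w1 = 0.
  by rewrite /w1 -[free_map _ _ _]/(fmap (klin k B) i1 w) ntm_nat h // linear0.
have -> : klin_nt k (proj (L i)) t w2 =
    free_map k (fun c => fmap (quo_functor (L i)) i1 c + qpi (L i t) (fmap B i2 n))
      (klin_nt k (proj (L i)) y w).
  rewrite /= !free_map_comp; apply: eq_free_map => c.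
  by rewrite /= linearD quomod_mapE.
by rewrite h // linear0 subr0.
Qed.

Lemma klin_proj_le (P N : subfunctor B) y (w : klin k B y) :
  sub_le P N -> klin_nt k (proj P) y w = 0 -> klin_nt k (proj N) y w = 0.
Proof.
move=> PN w0; have PN' z v : v \in P z -> nt_id B z v \in N z by apply: PN.
have -> : klin_nt k (proj N) y w = klin_nt k (nt_comp (quo_nt PN') (proj P)) y w.
  by apply: klin_nt_ext => v; rewrite /= quomod_mapE.
by rewrite klin_nt_comp w0 linear0.
Qed.

Section Coefficient.
Context (M : aut_module k B) (y : C) (b : B y) (gb : generates b).

(** The coefficient of [[b]] in [m (x) [c]]: if [c = g b], then [m (x) [c] = g^-1 m (x) [b]].
    Non-generators are outside the orbit of [b] and get the default zero. *)
Let beta (m : M) (c : B y) : M :=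
  if pselect (exists g : aut B, c = g y b) is left e then am_act M (aut_inv (projT1 (cid e))) m
  else 0.
Let betaE m (g : aut B) : beta m (g y b) = am_act M (aut_inv g) m.
Proof.
rewrite /beta; case: pselect => [e|[]]; last by exists g.
case: (cid e) => h eh /=; congr (am_act M (aut_inv _) m).
exact: aut_generator_inj (esym eh).
Qed.
Let betaN m c : ~ (exists g : aut B, c = g y b) -> beta m c = 0.
Proof. by rewrite /beta; case: pselect. Qed.

Lemma coefficient_functional : exists h : {linear lower_tensor M y -> M},
  (forall m : M, h (ten m << b >>) = m) /\
  forall (m : M) c, ~ (exists g : aut B, c = g y b) -> h (ten m << c >>) = 0.
Proof.
have [|||h hE] := @lt_mu_lift k C B M (lower_tensor M) y M beta.
- move=> a m m' c; rewrite /beta; case: pselect => [e|_]; first by rewrite linearP.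
  by rewrite scaler0 addr0.
- move=> m c ng; apply: betaN => -[g e]; apply: ng; rewrite e; exact: generates_aut.
- move=> g m c; have [[h ->]|nh] := pselect (exists h : aut B, c = h y b); last first.
    rewrite !betaN // => -[h e]; apply: nh; exists (aut_mul (aut_inv g) h).
    by rewrite /= -e aut_fwdK.
  rewrite -[g y (h y b)]/(aut_mul g h y b) !betaE -am_actM.
  congr (am_act M _ m); apply: aut_ext => x v /=; by rewrite aut_fwdK.
exists h; split=> [m|m c nc]; rewrite hE; last exact: betaN.
rewrite -[b in beta m b]/(aut_one B y b) betaE -[RHS]am_act1.
by congr (am_act M _ m); apply: aut_ext.
Qed.
End Coefficient.

(** Applied to all the [L j], [kernel_element] gives an element of Q^B with coefficient 1 at [b] and
    no other term in the orbit of [b]; its tensor product with [m] has coefficient [m] at [b]. *)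
Lemma ten_common_kernel_neq0 (M : aut_module k B) (m : M) x (a : B x)
    (n : nat) (L : nat -> subfunctor B) :
  generates a ->
  (forall P, exists2 j, (j < n)%N & sub_le P (L j) /\ sub_le (L j) P) -> m <> 0 ->
  exists y q, q \in common_kernel k B y /\ ten m q <> 0.
Proof.
move=> ga hL m0; have [y [b [w [p [gpb wb wc ws]]]]] := kernel_element (iota 0 n) L ga.
have gb : generates b.
  by move=> z v; have [f ->] := gpb z v; exists (comp f p); rewrite fmapM.
exists y, w; split.
  apply/common_kernelP => N nz; have [j lt [NL LN]] := hL N.
  apply: (klin_proj_le LN); apply: ws; first by rewrite mem_iota.
  by move=> z; apply: nz => t v /NL/z.
have [h [hb hc]] := coefficient_functional M gb.
move=> /(congr1 h); rewrite linear0 => e; apply: m0; rewrite -e.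
rewrite -[w]freeg_sumE linear_sum linear_sum /= (bigD1_seq b) ?uniq_dom //=; last first.
  by rewrite mem_dom wb oner_eq0.
rewrite wb hb big_seq_cond big1 ?addr0 // => c /andP[]; rewrite mem_dom => cw cb.
rewrite freegUZ !linearZ_LR /= hc ?scaler0 // => -[g eg]; case/eqP: cb.
(* A term [g b] of [w] has the same image under [p] as [b]. That image is a generator, so [g] is the
   identity. *)
have := wc c cw; rewrite eg -ntm_nat => gp.
have -> : g = aut_one B by exact: (@aut_generator_inj _ _ _ _ g (aut_one B) gpb gp).
by [].
Qed.
End NonVanishing.

(** * Finiteness *)

Section FinitelyManySubfunctors.
Context (C : additive_category) (A : rep C).

(** Going up a step from [Q] to [S], take the biproduct of the object found for [Q] with an object
    where [S] exceeds [Q]. *)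
Lemma ser_detecting_object (PP : functor C int -> Prop) (P Q : subfunctor A) :
  ser PP P Q -> sub_zero P ->
  exists y, forall T T' : subfunctor A, sub_le T T' -> sub_le T' Q ->
    (forall v, v \in T' y -> v \in T y) -> sub_le T' T.
Proof.
elim=> [{}Q _ QP|{}Q S _ IH [QS SQ simp] _] P0.
  have [z _] := addcat_zero C; exists z => T T' _ T'Q _ x v /T'Q/QP/P0 ->.
  exact: rpred0.
have [y hy] := IH P0; have [z [v0 v0S v0Q]] := (not_leP _ _).1 SQ.
have [t [i1 [i2 [p1 [p2 [e1 e2 e3 e4 e5]]]]]] := addcat_biproducts y z.
exists t => T T' TT' T'S tT.
have restrict w (i : hom w t) (p : hom t w) : comp p i = idm w ->
    forall v, v \in T' w -> v \in T w.
  move=> pi v vT'; rewrite -[v]fmap1 -pi fmapM.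
  by apply/sub_stable/tT/sub_stable.
have cap_T : sub_le (sf_cap T' Q) (sf_cap T Q).
  apply: hy; [|exact: cap_ler|].
    by apply: le_cap; [apply: sub_le_trans (@cap_lel _ _ _ _ _) TT'|apply: cap_ler].
  move=> v /sf_capP[vT' vQ]; apply/sf_capP; split=> //.
  exact: restrict e1 _ vT'.
(* By simplicity of [S / Q], either [T], and then also [T'], lies below [Q], or [Q + T] is all of
   [S] and the modular law reduces the claim to [cap_T]. *)
case: (simp (sf_add Q T)); first exact: le_addl.
- by apply: add_le => //; apply: sub_le_trans T'S.
- move=> le; have TQ : sub_le T Q by apply: sub_le_trans le; apply: le_addr.
  case: (simp (sf_add Q T')); first exact: le_addl.
  + exact: add_le.
  + move=> le' x v vT'.
    have vQ : v \in Q x by apply/le'/le_addr.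
    by have /sf_capP[] : v \in sf_cap T Q x by apply/cap_T/sf_capP.
  + move=> le'; case: v0Q; have /sf_addP[q [u [qQ uT' ->]]] := le' _ _ v0S.
    by rewrite rpredD //; apply/TQ/(restrict _ _ _ e2).
- move=> le x v vT'; have /sf_addP[q [u [qQ uT e]]] := le _ _ (T'S _ _ vT').
  rewrite e rpredD //; have /sf_capP[] // : q \in sf_cap T Q x.
  apply/cap_T/sf_capP; split=> //.
  by rewrite -(addrK u q) -e; apply: submodB => //; apply: TT'.
Qed.

(** A subfunctor is determined by its value at the detecting object, a subset of a finite set,
    encoded as a tuple of booleans. *)
Lemma finitely_many_subfunctors (k : fieldType) n : k_trivial k C -> has_rank A n ->
  exists m (L : nat -> subfunctor A),
    forall P, exists2 j, (j < m)%N & sub_le P (L j) /\ sub_le (L j) P.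
Proof.
move=> triv rA; have [x [a ga]] := exists_generator rA.
have /finite_length_ser s := has_rank_finite_length rA.
have [|y hy] := ser_detecting_object s; first by move=> z v /sf_zeroP.
have [e he] := finite_values triv y ga.
pose J : finType := (size e).-tuple bool.
pose f (P : subfunctor A) : J := [tuple of [seq v \in P y | v <- in_tuple e]].
(* One subfunctor for each tuple that occurs; [sf_full A] is a default for the others. *)
pose g (j : J) := if pselect (exists P, f P = j) is left h then projT1 (cid h) else sf_full A.
have gE P : f (g (f P)) = f P.
  by rewrite /g; case: pselect => [h|[]]; [case: (cid h) | exists P].
have fP P Q : f P = f Q -> sub_le P Q.
  move=> fPQ; suff: sub_le P (sf_cap P Q) by move=> le x' v /le/sf_capP[].
  apply: hy; [exact: cap_lel|exact: sub_le1|] => v vP; apply/sf_capP; split=> //.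
  have /(congr1 val)/eq_in_map/(_ v (he v)) <- // : f P = f Q := fPQ.
exists #|{: J}|, (fun i => g (nth (f (sf_full A)) (enum J) i)) => P.
exists (index (f P) (enum J)); first by rewrite cardE index_mem mem_enum.
by rewrite nth_index ?mem_enum //; split; apply: fP; rewrite gE.
Qed.
End FinitelyManySubfunctors.

(** * Finite dimensional modules *)

Section ModuleRank.
Context (k : fieldType).

(** Finite dimensionality in the same form as [has_rank], suited to induction over quotient
    modules. *)
Definition mod_rank (V : lmodType k) (n : nat) : Prop :=
  exists h : submodClosed V -> nat,
  (forall S T : submodClosed V, (forall v, v \in S -> v \in T) ->
     ~ (forall v, v \in T -> v \in S) -> (h S < h T)%N) /\ forall S, (h S <= n)%N.

(* The rank of [S] is the number of pivots of its echelon form. *)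
Lemma mod_rank_free (X : choiceType) (e : seq X) : (forall x, x \in e) ->
  mod_rank {freeg X / k} (size e).
Proof.
move=> he.
pose lower (j : nat) (w : {freeg X / k}) := forall i x, (i < j)%N -> onth e i = Some x -> coeff x w = 0.
pose piv j (S : submodClosed {freeg X / k}) :=
  `[< exists w x, [/\ w \in S, lower j w, onth e j = Some x & coeff x w != 0] >].
exists (fun S => \sum_(j < size e) piv j S)%N; split=> [S T ST TS|S]; last first.
  by rewrite -[leqRHS]card_ord -sum1_card; apply: leq_sum => i _; exact: leq_b1.
have mono j : piv j S -> piv j T.
  by move=> /asboolP[w [x [wS lw ej nz]]]; apply/asboolP; exists w, x; split=> //; apply: ST.
rewrite ltnNge; apply/negP => hle; apply: TS.
have pTS j : (j < size e)%N -> piv j T -> piv j S.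
  move=> lt pT; apply: contraLR hle => pS; rewrite -ltnNge.
  rewrite (bigD1 (Ordinal lt)) //= (negPf pS) add0n.
  rewrite [ltnRHS](bigD1 (Ordinal lt)) //= pT ltnS.
  by apply: leq_sum => i _; case E: (piv i S) => //; rewrite (mono _ E).
(* Gaussian elimination, by induction on the number [m] of final positions where [w] may be nonzero.
   [S] has a pivot wherever [T] has one. *)
suff main m w : (m <= size e)%N -> w \in T -> lower (size e - m)%N w -> w \in S.
  by move=> w wT; apply: (main (size e)) => //; rewrite subnn.
elim: m w => [|m IH] w lt wT.
  rewrite subn0 => lw; suff -> : w = 0 by apply: rpred0.
  apply/eqP/freeg_eqP => x; rewrite coeff0.
  apply: (lw (index x e)); first by rewrite index_mem.
  by rewrite onthE (nth_map x) ?index_mem // nth_index.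
set j := (size e - m.+1)%N => lw.
have je : (size e - m)%N = j.+1 by rewrite /j subnSK.
have jlt : (j < size e)%N by rewrite /j ltn_subrL /=; apply: leq_trans lt.
have [x ex] : exists x, onth e j = Some x.
  case: (e) (jlt) => // x0 s lt'; exists (nth x0 (x0 :: s) j).
  by rewrite onthE (nth_map x0).
have next u : lower j u -> coeff x u = 0 -> lower (size e - m)%N u.
  rewrite je => lu ux i y; rewrite ltnS leq_eqVlt => /orP[/eqP->|]; last exact: lu.
  by rewrite ex => -[<-].
have [wx|wx] := eqVneq (coeff x w) 0; first by apply: IH (ltnW lt) wT (next _ lw wx).
have /asboolP[u [x' [uS lu]]] : piv j S.
  by apply: pTS => //; apply/asboolP; exists w, x.
rewrite ex => -[<-] ux.
set c := coeff x w / coeff x u.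
have : w - c *: u \in S.
  apply: (IH _ (ltnW lt)); first by apply: submodB => //; apply/rpredZ/ST.
  apply: next; last by rewrite coeffB coeffZ divfK // subrr.
  by move=> i y ilt ey; rewrite coeffB coeffZ (lw i) // (lu i) // mulr0 subr0.
by move=> h; rewrite -(subrK (c *: u) w) rpredD ?rpredZ.
Qed.
End ModuleRank.

Section SubQuotientModules.
Context (k : fieldType) (C : preadditive) (R : pzRingType) (B : functor C R).
Context (M : aut_module k B) (S : submodClosed M).
Hypothesis S_stable : forall g m, m \in S -> am_act M g m \in S.

Let sact g : {linear submodule S -> submodule S} := submod_map (am_act M g) (S_stable g).
Let sact1 m : sact (aut_one B) m = m.
Proof. by apply: val_inj; rewrite /= am_act1. Qed.
Let sactM g h m : sact (aut_mul g h) m = sact g (sact h m).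
Proof. by apply: val_inj; rewrite /= am_actM. Qed.
Definition sub_aut_module : aut_module k B := AutModule sact1 sactM.

Let qact g : {linear quomod S -> quomod S} := quomod_map (am_act M g) (S_stable g).
Let qact1 m : qact (aut_one B) m = m.
Proof. by rewrite -[m]qreprK /qact /= quomod_mapE am_act1. Qed.
Let qactM g h m : qact (aut_mul g h) m = qact g (qact h m).
Proof. by rewrite -[m]qreprK /qact /= !quomod_mapE am_actM. Qed.
Definition quo_aut_module : aut_module k B := AutModule qact1 qactM.
End SubQuotientModules.

(** * Series of the tensor functors *)

Section SubmoduleConstructions.
Context (R : pzRingType) (V W : lmodType R) (f : {linear V -> W}) (S : submodClosed V).

Section Full.
Let P (v : V) : Prop := True.
Let P0 : P 0. Proof. by []. Qed.
Let PD u v : P u -> P v -> P (u + v). Proof. by []. Qed.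
Let PZ a v : P v -> P (a *: v). Proof. by []. Qed.
Definition full_submod : submodClosed V := mk_submod P0 PD PZ.
Lemma full_submodP v : v \in full_submod. Proof. exact/mk_submodP. Qed.
End Full.

Section Image.
Let P (w : W) : Prop := exists2 v, v \in S & w = f v.
Let P0 : P 0. Proof. by exists 0; rewrite ?rpred0 ?linear0. Qed.
Let PD u v : P u -> P v -> P (u + v).
Proof. by move=> [a ? ->] [b ? ->]; exists (a + b); rewrite ?rpredD ?linearD. Qed.
Let PZ a v : P v -> P (a *: v).
Proof. by move=> [b ? ->]; exists (a *: b); rewrite ?rpredZ ?linearZ. Qed.
Definition img_submod : submodClosed W := mk_submod P0 PD PZ.
Lemma img_submodP w : w \in img_submod <-> exists2 v, v \in S & w = f v.
Proof. by split=> [/mk_submodP|?] //; apply/mk_submodP. Qed.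
End Image.
End SubmoduleConstructions.

Lemma sub_functor_subquo (C : preadditive) (R : pzRingType) (F : functor C R)
  (T : subfunctor F) : isomorphic (sub_functor T) (subquo T (sf_zero F)).
Proof.
apply: (bijective_isomorphic (a := proj (sub_preim (incl T) (sf_zero F)))) => x v.
  by move/qpi_eq0P; rewrite submod_preimE => /sf_zeroP v0; apply: val_inj.
by exists (qrepr v); rewrite /= qreprK.
Qed.

Lemma mod_rank_quo (k : fieldType) (V : lmodType k) n (S : submodClosed V) :
  mod_rank V n -> (exists2 v, v \in S & v <> 0) ->
  exists2 m, (m < n)%N & mod_rank (quomod S) m.
Proof.
move=> [h [strict bound]] [v vS v0].
pose Z := ker_submod (idfun : {linear V -> V}).
have gt T : (0 < h (submod_preim (qpi S) T))%N.
  apply: leq_ltn_trans (strict Z _ _ _); first by [].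
    by move=> u /ker_submodP /= ->; rewrite submod_preimE linear0 rpred0.
  move=> le; apply/v0/(ker_submodP idfun)/le.
  by rewrite submod_preimE /= (qpi_eq0P _ _ vS) rpred0.
have n0 : (0 < n)%N by apply: leq_trans (gt (full_submod _)) (bound _).
exists n.-1; first by rewrite prednK.
exists (fun T => (h (submod_preim (qpi S) T)).-1); split=> [T U TU UT|T]; last first.
  by rewrite -ltnS !prednK.
rewrite -ltnS !prednK //; apply: strict.
  by move=> u; rewrite !submod_preimE; apply: TU.
move=> le; apply: UT => u uU; rewrite -[u]qreprK.
by have := le (qrepr u); rewrite !submod_preimE /= qreprK; apply.
Qed.

Section SimpleStable.
Context (k : fieldType) (C : preadditive) (R : pzRingType) (B : functor C R).
Context (M : aut_module k B).

(** A nonzero stable submodule of least rank is simple. *)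
Lemma exists_simple_submodule n : mod_rank M n -> (exists m : M, m <> 0) ->
  exists (S : submodClosed M) (hS : forall g m, m \in S -> am_act M g m \in S),
    (exists2 m, m \in S & m <> 0) /\ simple_module (sub_aut_module hS).
Proof.
move=> [h [strict bound]] [m0 nz].
pose p i := `[< exists S : submodClosed M, [/\ forall g m, m \in S -> am_act M g m \in S,
  exists2 m, m \in S & m <> 0 & h S = i] >].
have ex : exists i, p i.
  exists (h (full_submod M)); apply/asboolP; exists (full_submod M); split=> //.
  by exists m0; first exact: full_submodP.
case: (ex_minnP ex) => i /asboolP[S [hS [m mS m_nz] hSi]] min.
exists S, hS; split; first by exists m.
split; first by exists (SubModule mS); apply/eqP => /(congr1 val).
move=> T hT; have [Tz|Tnz] := pselect (forall s, s \in T -> s = 0); [by left|right].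
pose T' := img_submod (@smval k M S) T.
have T'P s : val s \in T' -> s \in T.
  by move/img_submodP=> [t tT /val_inj ->].
have T'S v : v \in T' -> v \in S by move=> /img_submodP[[t tS] _ ->].
suff ST' : forall v, v \in S -> v \in T' by move=> s; apply/T'P/ST'/valP.
apply: contrapT => nST'; have := strict _ _ T'S nST'; rewrite hSi ltnNge min //.
apply/asboolP; exists T'; split=> //.
  move=> g v /img_submodP[t tT ->]; apply/img_submodP.
  by exists (am_act (sub_aut_module hS) g t); rewrite ?hT.
apply: contrapT => H; apply: Tnz => s sT; apply: contrapT => s0; apply: H.
exists (val s); first by apply/img_submodP; exists s.
by move=> e; apply: s0; apply: val_inj.
Qed.
End SimpleStable.

(** * Right exactness in the module *)

Section RightExactness.
Context (k : fieldType) (C : additive_category) (B : rep C) (M : aut_module k B).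
Context (S : submodClosed M) (hS : forall g m, m \in S -> am_act M g m \in S).
Local Notation X N := (lower_tensor N).

(** A map [phi] from the functor of the quotient module to the cokernel of [j] is built by lifting
    elements of the quotient to [M]. Then [phi] composed with [p] is the projection, so whatever [p]
    kills lies in the image of [j]. *)
Lemma lower_tensor_right_exact :
  exists (j : X (sub_aut_module hS) ~> X M) (p : X M ~> X (quo_aut_module hS)),
    forall y v, p y v = 0 -> v \in sf_img j (sf_full _) y.
Proof.
have [||||j jE] := @ten_lift_nt _ _ _ (sub_aut_module hS) (X M)
   (fun y m b => ten (val m : M) << b >>).
- by move=> y a m m' b; rewrite linearP lt_muP.
- by move=> y m b; apply: lt_mu_nongenerator.
- by move=> y g m b; rewrite /= -[RHS](lt_mu_aut _ g) /= free_mapU.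
- by move=> y z f m b; rewrite ten_nat /= free_mapU.
have [||||p pE] := @ten_lift_nt _ _ _ M (X (quo_aut_module hS))
   (fun y m b => ten (qpi S m : quo_aut_module hS) << b >>).
- by move=> y a m m' b; rewrite linearP lt_muP.
- by move=> y m b; apply: lt_mu_nongenerator.
- move=> y g m b; rewrite -[RHS](lt_mu_aut _ g) /= free_mapU; congr (lt_mu _ _ _ _).
  by rewrite quomod_mapE.
- by move=> y z f m b; rewrite ten_nat /= free_mapU.
exists j, p.
pose I := sf_img j (sf_full _).
(* Changing a lift by an element of [S] changes the tensor by an element of the image of [j], so
   [phi] does not depend on the lifts. *)
have reprE y (m : M) (b : B y) :
    qpi (I y) (ten (qrepr (qpi S m)) << b >>) = qpi (I y) (ten m << b >>).
  have mS : qrepr (qpi S m) - m \in S by apply/qpiP; rewrite qreprK.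
  apply/qpiP.
  have -> : ten (qrepr (qpi S m)) << b >> - ten m << b >> = j y (ten (SubModule mS : sub_aut_module hS) << b >>).
    by rewrite jE /= tenBl.
  by apply: mem_img; apply: sf_fullP.
have [||||phi phiE] := @ten_lift_nt _ _ _ (quo_aut_module hS) (quo_functor I)
   (fun y m b => qpi (I y) (ten (qrepr m : M) << b >>)).
- move=> y a m m' b; rewrite -[m]qreprK -[m']qreprK -linearP !reprE -linearP.
  by rewrite -lt_muP.
- by move=> y m b ng; rewrite lt_mu_nongenerator // linear0.
- move=> y g m b; rewrite -[m]qreprK.
  have -> : am_act (quo_aut_module hS) g (qpi S (qrepr m)) = qpi S (am_act M g (qrepr m)).
    exact: quomod_mapE.
  by rewrite !reprE -[in RHS](lt_mu_aut _ g) /= free_mapU.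
- by move=> y z f m b; rewrite /= quomod_mapE ten_nat /= free_mapU.
move=> y v pv; apply/qpi_eq0P.
have -> : qpi (I y) v = phi y (p y v).
  apply: (ten_ext (f := qpi (I y)) (g := phi y \o p y)) => m b.
  by rewrite /= pE phiE reprE.
by rewrite pv linear0.
Qed.
End RightExactness.

Section TensorSeries.
Context (k : fieldType) (C : additive_category) (C_trivial : k_trivial k C).
Context (PP : functor C k -> Prop).
Hypothesis PP_iso : forall F G, isomorphic F G -> PP F -> PP G.
Context (B : rep C) (rB : exists n, has_rank B n).
Implicit Types M : aut_module k B.
Local Notation X M := (lower_tensor M).

(** The [m] with all [m (x) [b]] in the image form a stable submodule containing [m0]. Hence the
    tensor functor of a simple module is a quotient of [k[B]]. *)
Lemma simple_mu_surjective M (m0 : M) : simple_module M -> m0 <> 0 ->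
  sub_full (sf_img (lt_mu (X M) m0) (sf_full _)).
Proof.
move=> [_ simp] nz; set I := sf_img _ _.
pose P (m : M) := forall y (b : B y), ten m << b >> \in I y.
have P0 : P 0 by move=> y b; rewrite ten0l rpred0.
have PD m1 m2 : P m1 -> P m2 -> P (m1 + m2).
  by move=> h1 h2 y b; rewrite tenDl rpredD ?h1 ?h2.
have PZ a m : P m -> P (a *: m) by move=> h y b; rewrite tenZl rpredZ ?h.
case: (simp (mk_submod P0 PD PZ)).
- move=> g m /mk_submodP h; apply/mk_submodP => y b.
  rewrite -[b](aut_bwdK g) -(free_mapU k (g y)) [lt_mu _ _ _ _](lt_mu_aut _ g).
  exact: h.
- move=> h; case: nz; apply: h; apply/mk_submodP => y b.
  by apply: mem_img; apply: sf_fullP.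
- move=> h y v; elim/lt_mu_ind: v => [|u v|m b]; [exact: rpred0|exact: rpredD|].
  by have /mk_submodP := h m; apply.
Qed.

(** Q(B, M) is simple: nonzero by [ten_common_kernel_neq0], and minimal by [Qsub_minimal]. *)
Lemma Qsub_cover M : simple_module M -> cover (sf_zero (X M)) (lt_Qsub (X M)).
Proof.
move=> simp; have [n rk] := rB; have [x [a ga]] := exists_generator rk.
have [m [L hL]] := finitely_many_subfunctors C_trivial rk.
have [[m0 /eqP nz] _] := simp.
have [y [q [qK q0]]] := ten_common_kernel_neq0 ga hL nz.
split; first exact: sub_le0.
  by move=> /le_zeroP/(_ _ _ (lt_mem_Qsub (X M) m0 qK)).
move=> T _ _; have [Tz|Tnz] := pselect (sub_zero T); first by left; apply/le_zeroP.
by right; apply: Qsub_minimal.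
Qed.

Hypothesis kernel_top : ser PP (common_kernel k B) (sf_full (klin k B)).
Hypothesis simple_PP : forall M, simple_module M -> PP (Qfunctor M).

(** Q(B, M) is the first step. Above it, take the image under [m0 (x) -] of the series of [k[B]]
    above Q^B, since this map sends Q^B into Q(B, M). *)
Lemma ser_simple_tensor M : simple_module M -> ser PP (sf_zero (X M)) (sf_full (X M)).
Proof.
move=> simp; have [[m0 /eqP nz] _] := simp.
apply: (@ser_trans _ _ _ PP_iso _ _ (lt_Qsub (X M))).
  apply: (ser_cons (Q := sf_zero _)); first exact: ser_nil.
    exact: Qsub_cover.
  apply: PP_iso (simple_PP simp).
  exact: isomorphic_trans (lt_Qfunctor _) (sub_functor_subquo _).
have s := ser_img PP_iso (lt_mu (X M) m0) (lt_Qsub (X M)) kernel_top.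
apply: (ser_equivl PP_iso (ser_equivr PP_iso s _ _)).
- exact: sub_le1.
- by move=> y v _; apply/le_addl/simple_mu_surjective.
- apply: add_le => // y v /sf_imgP[q qK ->]; exact: lt_mem_Qsub.
- exact: le_addr.
Qed.

(** Split off a simple submodule [S] and use induction for [M / S]. Right exactness suffices,
    because the image of a series under [j] is a series even when [j] is not injective. *)
Lemma ser_module_tensor n M : mod_rank M n -> ser PP (sf_zero (X M)) (sf_full (X M)).
Proof.
have [b] := ubnP n; elim: b n M => // b IH n M lt rM.
have [nz|z] := pselect (exists m : M, m <> 0); last first.
  apply: ser_nil; first exact: sub_le0.
  move=> y v _; apply/sf_zeroP; elim/lt_mu_ind: v => // [u v -> ->|m b'].
    by rewrite addr0.
  have -> : m = 0 by apply: contrapT => m0; apply: z; exists m.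
  exact: ten0l.
have [S [hS [Snz Ssimp]]] := exists_simple_submodule rM nz.
have [j [p jp]] := lower_tensor_right_exact hS.
have [n' n'lt rQ] := mod_rank_quo rM Snz.
have sQ := IH n' (quo_aut_module hS) (leq_trans n'lt (ltnSE lt)) rQ.
have sS := ser_simple_tensor Ssimp.
pose I := sf_img j (sf_full _).
apply: (@ser_trans _ _ _ PP_iso _ _ I).
  have s := ser_img PP_iso j (sf_zero _) sS.
  apply: (ser_equivl PP_iso (ser_equivr PP_iso s _ _)).
  - by apply: add_le => //; apply: sub_le0.
  - exact: le_addl.
  - apply: add_le => // y v /sf_imgP[u /sf_zeroP -> ->]; rewrite linear0; exact: rpred0.
  - exact: sub_le0.
have s := ser_add PP_iso I (ser_preim PP_iso p (sf_full _) sQ).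
apply: (ser_equivl PP_iso (ser_equivr PP_iso s _ _)).
- exact: sub_le1.
- move=> y v _; apply/le_addl/sf_capP; rewrite sub_preimE.
  by split; apply: sf_fullP.
- apply: add_le => // y v /sf_capP[]; rewrite sub_preimE => /sf_zeroP pv _.
  exact: jp.
- exact: le_addr.
Qed.
End TensorSeries.

(** * Series of the linearization *)

Section Point.
Context (k : fieldType) (C : additive_category) (B : rep C).

Definition point_module (x : C) : aut_module k B :=
  @AutModule k C int B (klin k B x) (fun g => klin_nt k g x) (@klin_nt_id k C int B x)
    (fun g h => @klin_nt_comp k C int B B B g h x).

(** The map sends [[g a] (x) [b]] to [q [g^-1 b]], and [[c] (x) [b]] to zero for [c] outside the
    orbit of [a]; freeness on generators makes it well defined. On [[a] (x) [b]] it recovers [q]. *)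
Lemma point_tensor_surjective x (a : B x) (G : functor C k) (q : klin k B ~> G) :
  generates a -> (forall y (b : B y), ~ generates b -> q y << b >> = 0) ->
  (forall y v, exists w, q y w = v) ->
  exists h : lower_tensor (point_module x) ~> G, forall y v, exists u, h y u = v.
Proof.
move=> ga Q0 qs.
pose theta y (b : B y) (c : B x) : G y :=
  if pselect (exists g : aut B, c = g x a) is left e
  then q y << aut_bwd (projT1 (cid e)) y b >> else 0.
have thetaE y b (g : aut B) : theta y b (g x a) = q y << aut_bwd g y b >>.
  rewrite /theta; case: pselect => [e|[]]; last by exists g.
  case: (cid e) => h eh /=; have -> // : h = g.
  exact: (aut_generator_inj ga (esym eh)).
have thetaN y b c : ~ (exists g : aut B, c = g x a) -> theta y b c = 0.
  by rewrite /theta; case: pselect.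
pose L y b : {linear {freeg (B x) / k} -> G y} := fglift (theta y b).
have LU y b c : L y b << c >> = theta y b c by apply: fgliftU.
have [||||h hE] := @ten_lift_nt k C B (point_module x) (G) (fun y m b => L y b m).
- by move=> y c m m' b; apply: (linearP (L y b)).
- move=> y m b ng; apply: (freeg_ext (f := L y b) (g := \0)) => c.
  rewrite LU; have [[g ->]|nc] := pselect (exists g : aut B, c = g x a); last exact: thetaN.
  rewrite thetaE; apply: Q0 => gb; apply: ng.
  by rewrite -[b](aut_bwdK g); apply: generates_aut.
- move=> y g m b; apply: (freeg_ext (f := L y (g y b) \o klin_nt k g x) (g := L y b)) => c.
  rewrite /= free_mapU !LU.
  have [[g' ->]|nc] := pselect (exists g' : aut B, c = g' x a); last first.
    rewrite !thetaN // => -[g' e]; apply: nc; exists (aut_mul (aut_inv g) g').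
    by rewrite /= -e aut_fwdK.
  by rewrite -[g x (g' x a)]/(aut_mul g g' x a) !thetaE /= aut_fwdK.
- move=> y z f m b.
  apply: (freeg_ext (f := fmap (G) f \o L y b) (g := L z (fmap B f b))) => c.
  rewrite /= !LU.
  have [[g ->]|nc] := pselect (exists g : aut B, c = g x a); last first.
    by rewrite !thetaN // linear0.
  by rewrite !thetaE -ntm_nat /= free_mapU ntm_nat.
exists h => y v; have [w <-] := qs y v; elim/freeg_span: w.
- by exists 0; rewrite !linear0.
- by move=> u w [u' eu] [w' ew]; exists (u' + w'); rewrite !linearD eu ew.
- by move=> c u [u' eu]; exists (c *: u'); rewrite !linearZ eu.
- move=> b; exists (ten (<< a >> : point_module x) << b >>).
  by rewrite hE LU -[a]/(aut_one B x a) thetaE.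
Qed.
End Point.

(** * Transitivity of subquotients and of their simple factors *)

Section SubquotientTransitivity.
Context (C : preadditive) (R : pzRingType) (A : functor C R).

Lemma subquotient_refl : subquotient A A.
Proof.
exists (sf_zero A), (sf_full A); split; first exact: sub_le0.
apply: isomorphic_trans (sub_functor_subquo (sf_full A)).
apply: isomorphic_sym; apply: (bijective_isomorphic (a := incl (sf_full A))) => x v.
  by move=> v0; apply: val_inj.
by exists (SubModule (sf_fullP v)).
Qed.

Lemma subquotient_sub (P : subfunctor A) (B : functor C R) :
  subquotient B (sub_functor P) -> subquotient B A.
Proof.
move=> [S [T [ST iso]]]; exists (sf_img (incl P) S), (sf_img (incl P) T).
split; first exact: img_le.
apply: isomorphic_trans iso _; apply: (@subquo_iso _ _ _ _ (incl P)).
- by move=> x v vT; apply: mem_img.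
- by move=> x v _ vS; apply: mem_img.
- by move=> x v _ /sf_imgP[w wS /val_inj ->].
- by move=> x w /sf_imgP[v vT ->]; exists v; rewrite // subrr rpred0.
Qed.

Lemma subquotient_quo (N : subfunctor A) (B : functor C R) :
  subquotient B (quo_functor N) -> subquotient B A.
Proof.
move=> [S [T [ST iso]]]; exists (sub_preim (proj N) S), (sub_preim (proj N) T).
split; first exact: preim_le.
apply: isomorphic_trans iso _; apply: isomorphic_sym.
apply: (@subquo_iso _ _ _ _ (proj N)).
- by move=> x v; rewrite sub_preimE.
- by move=> x v _; rewrite sub_preimE.
- by move=> x v _; rewrite sub_preimE.
- move=> x w wT; exists (qrepr w); first by rewrite sub_preimE /= qreprK.
  by rewrite /= qreprK subrr rpred0.
Qed.

(** For [S] a composition factor this form, which mentions no series, transfers directly along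
    injections and surjections; [composition_factorP] makes the link. *)
Definition subfactor (F S : functor C R) : Prop :=
  exists P Q : subfunctor F, cover P Q /\ isomorphic S (subquo Q P).

Lemma subfactor_injective (F G S : functor C R) (a : F ~> G) :
  (forall x v, a x v = 0 -> v = 0) -> subfactor F S -> subfactor G S.
Proof.
move=> inj [P [Q [cov iso]]]; have [PQ _ _] := cov.
have iso' : isomorphic (subquo Q P) (subquo (sf_img a Q) (sf_img a P)).
  apply: (@subquo_iso _ _ _ _ a).
  - by move=> x v vT; apply: mem_img.
  - by move=> x v _ vS; apply: mem_img.
  - move=> x v _ /sf_imgP[w wS e]; have -> // : v = w.
    by apply/subr0_eq/inj; rewrite linearB e subrr.
  - by move=> x w /sf_imgP[v vT ->]; exists v; rewrite // subrr rpred0.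
exists (sf_img a P), (sf_img a Q); split; last exact: isomorphic_trans iso'.
by apply: cover_isom iso' cov => //; apply: img_le.
Qed.

Lemma subfactor_surjective (F G S : functor C R) (a : F ~> G) :
  (forall x v, exists u, a x u = v) -> subfactor G S -> subfactor F S.
Proof.
move=> surj [P [Q [cov iso]]]; have [PQ _ _] := cov.
have iso' : isomorphic (subquo (sub_preim a Q) (sub_preim a P)) (subquo Q P).
  apply: (@subquo_iso _ _ _ _ a).
  - by move=> x v; rewrite sub_preimE.
  - by move=> x v _; rewrite sub_preimE.
  - by move=> x v _; rewrite sub_preimE.
  - move=> x w wT; have [u e] := surj x w; exists u; first by rewrite sub_preimE e.
    by rewrite e subrr rpred0.
exists (sub_preim a P), (sub_preim a Q); split.
  by apply: cover_isom (isomorphic_sym iso') cov => //; apply: preim_le.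
exact: isomorphic_trans iso (isomorphic_sym iso').
Qed.
End SubquotientTransitivity.

Section LinearizationSeries.
Context (k : fieldType) (C : additive_category) (C_trivial : k_trivial k C).

Definition sub_rep (A : rep C) (P : subfunctor A) : rep C := Rep (@sub_functor_additive C A P).
Definition quo_rep (A : rep C) (P : subfunctor A) : rep C := Rep (@quo_functor_additive C A P).

Context (PP : functor C k -> Prop).
Hypothesis PP_iso : forall F G, isomorphic F G -> PP F -> PP G.

Section FiniteSubfunctors.
Context (A : rep C) (m : nat) (L : nat -> subfunctor A).
Hypothesis hL : forall P, exists2 j, (j < m)%N & sub_le P (L j) /\ sub_le (L j) P.

(** The images of the [k[L j]], for [L j] proper, are added one at a time, each contributing the
    image of a series of [k[L j]]. *)
Lemma ser_proper_part :
  (forall P : subfunctor A, ~ sub_full P ->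
     ser PP (sf_zero (klin k (sub_functor P))) (sf_full (klin k (sub_functor P)))) ->
  ser PP (sf_zero (klin k A)) (proper_part k A).
Proof.
move=> hP; pose im j := sf_img (klin_nt k (incl (L j))) (sf_full _).
have im_le j : ~ sub_full (L j) -> sub_le (im j) (proper_part k A).
  move=> nf y v /sf_imgP[u _ ->]; apply: sub_span_of; exists (L j); split=> //.
  by exists u.
have h i : exists S, [/\ ser PP (sf_zero (klin k A)) S, sub_le S (proper_part k A)
    & forall j, (j < i)%N -> ~ sub_full (L j) -> sub_le (im j) S].
  elim: i => [|i [S [s Sle hS]]].
    by exists (sf_zero (klin k A)); split=> //; [apply: ser_nil | apply: sub_le0].
  have [full|nf] := pselect (sub_full (L i)).
    by exists S; split=> // j; rewrite ltnS leq_eqVlt => /orP[/eqP->|/hS].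
  exists (sf_add (im i) S); split.
  - apply: (ser_trans PP_iso s).
    have s' := ser_img PP_iso (klin_nt k (incl (L i))) S (hP _ nf).
    apply: (ser_equivl PP_iso s'); last exact: le_addr.
    apply: add_le => // y v /sf_imgP[u /sf_zeroP -> ->]; rewrite linear0; exact: rpred0.
  - by apply: add_le => //; apply: im_le.
  - move=> j; rewrite ltnS leq_eqVlt => /orP[/eqP->|lt] nf'; first exact: le_addl.
    by apply: sub_le_trans (hS _ lt nf') (@le_addr _ _ _ _ _).
have [S [s Sle hS]] := h m; apply: (ser_equivr PP_iso s) => //.
move=> y v /span_ofP; apply=> w [P [nf [u ->]]].
have [j lt [PL LP]] := hL P.
have nfL : ~ sub_full (L j) by move=> full; apply: nf => z t; apply/LP/full.
apply: (hS j lt nfL); have PL' z t : t \in P z -> nt_id A z t \in L j z by apply: PL.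
apply/sf_imgP; exists (klin_nt k (sub_nt PL') y u); first exact: sf_fullP.
by rewrite -klin_nt_comp; apply: klin_nt_ext.
Qed.

(** Dually, the kernels of the maps to the [k[A / L j]], for [L j] nonzero, are intersected one at a
    time. *)
Lemma ser_common_kernel :
  (forall N : subfunctor A, ~ sub_zero N ->
     ser PP (sf_zero (klin k (quo_functor N))) (sf_full (klin k (quo_functor N)))) ->
  ser PP (common_kernel k A) (sf_full (klin k A)).
Proof.
move=> hN; pose ker j := sub_preim (klin_nt k (proj (L j))) (sf_zero _).
have le_ker j : ~ sub_zero (L j) -> sub_le (common_kernel k A) (ker j).
  by move=> nz y v /common_kernelP h; rewrite sub_preimE; apply/sf_zeroP/h.
have h i : exists S, [/\ ser PP S (sf_full (klin k A)), sub_le (common_kernel k A) S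
    & forall j, (j < i)%N -> ~ sub_zero (L j) -> sub_le S (ker j)].
  elim: i => [|i [S [s leS hS]]].
    by exists (sf_full (klin k A)); split=> //; [apply: ser_nil | apply: sub_le1].
  have [z|nz] := pselect (sub_zero (L i)).
    by exists S; split=> // j; rewrite ltnS leq_eqVlt => /orP[/eqP->|/hS].
  exists (sf_cap (ker i) S); split.
  - apply: (ser_trans PP_iso _ s).
    have s' := ser_preim PP_iso (klin_nt k (proj (L i))) S (hN _ nz).
    apply: (ser_equivr PP_iso s'); first exact: cap_ler.
    by apply: le_cap => // y v _; rewrite sub_preimE; apply: sf_fullP.
  - by apply: le_cap => //; apply: le_ker.
  - move=> j; rewrite ltnS leq_eqVlt => /orP[/eqP->|lt] nz'; first exact: cap_lel.
    by apply: sub_le_trans (@cap_ler _ _ _ _ _) (hS _ lt nz').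
have [S [s leS hS]] := h m; apply: (ser_equivl PP_iso s) => //.
move=> y v vS; apply/common_kernelP => N nz; have [j lt [NL LN]] := hL N.
have nzL : ~ sub_zero (L j) by move=> z; apply: nz => x t /NL/z.
apply: (klin_proj_le LN); apply/sf_zeroP.
by have := hS j lt nzL y v vS; rewrite sub_preimE.
Qed.
End FiniteSubfunctors.

Lemma ser_klin n (A : rep C) : has_rank A n ->
  (forall (B : rep C) (M : aut_module k B),
     subquotient B A -> simple_module M -> PP (Qfunctor M)) ->
  ser PP (sf_zero (klin k A)) (sf_full (klin k A)).
Proof.
have [b] := ubnP n; elim: b n A => // b IH n A lt rA hPP.
have [m [L hL]] := finitely_many_subfunctors C_trivial rA.
have lower : ser PP (sf_zero (klin k A)) (proper_part k A).
  apply: (ser_proper_part hL) => P nf; have [n' ltn' rP] := has_rank_sub rA nf.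
  apply: (IH n' (sub_rep P)) => //; first exact: leq_trans ltn' (ltnSE lt).
  by move=> B M sq; apply: hPP; apply: subquotient_sub sq.
have upper : ser PP (common_kernel k A) (sf_full (klin k A)).
  apply: (ser_common_kernel hL) => N nz; have [n' ltn' rN] := has_rank_quo rA nz.
  apply: (IH n' (quo_rep N)) => //; first exact: leq_trans ltn' (ltnSE lt).
  by move=> B M sq; apply: hPP; apply: subquotient_quo sq.
apply: (ser_trans PP_iso lower).
have [x [a ga]] := exists_generator rA.
have [e he] := finite_values C_trivial x ga.
(* The module [k[A(x)]] is finite dimensional because [A(x)] is finite. *)
have rM : mod_rank (point_module k A x) (size e) := mod_rank_free k he.
have s := ser_module_tensor C_trivial PP_iso (ex_intro _ n rA) upper
  (fun M => hPP A M (subquotient_refl A)) rM.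
have [||h surj] := point_tensor_surjective (q := proj (proper_part k A)) ga.
- move=> y c /not_generates[P [nf cP]]; apply/qpi_eq0P/sub_span_of.
  by exists P; split=> //; exists << (SubModule cP) >>; rewrite /= free_mapU.
- by move=> y v; exists (qrepr v); apply: qreprK.
(* The image under [h] is a series of Q_A; its preimage in [k[A]] runs from [proper_part] to the
   top. *)
have s1 := ser_img PP_iso h (sf_zero _) s.
have s2 := ser_preim PP_iso (proj (proper_part k A)) (sf_full _) s1.
apply: (ser_equivl PP_iso (ser_equivr PP_iso s2 _ _)).
- exact: sub_le1.
- move=> y v _; apply/sf_capP; split; last exact: sf_fullP.
  rewrite sub_preimE; apply/le_addl; have [u <-] := surj y (proj (proper_part k A) y v).
  exact/mem_img/sf_fullP.
- move=> y v /sf_capP[]; rewrite sub_preimE.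
  move=> /sf_addP[_ [_ [/sf_imgP[u /sf_zeroP -> ->] /sf_zeroP -> e0]]] _.
  by move: e0; rewrite linear0 addr0 => /qpi_eq0P.
- move=> y v vP; apply/sf_capP; split; last exact: sf_fullP.
  rewrite sub_preimE; have -> : proj (proper_part k A) y v = 0 by exact/qpi_eq0P.
  exact: rpred0.
Qed.

Lemma klin_injective (F G : functor C int) (a : F ~> G) :
  (forall x v, a x v = 0 -> v = 0) -> forall x w, klin_nt k a x w = 0 -> w = 0.
Proof.
move=> inj x w w0; apply/eqP/freeg_eqP => v; rewrite coeff0.
have a_inj : injective (a x).
  by move=> u t e; apply/subr0_eq/inj; rewrite linearB e subrr.
by rewrite -(coeff_free_map v w a_inj) [free_map _ _ _]w0 coeff0.
Qed.

Lemma klin_surjective (F G : functor C int) (a : F ~> G) :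
  (forall x v, exists u, a x u = v) -> forall x w, exists u, klin_nt k a x u = w.
Proof.
move=> surj x w; have surj' v : exists u, v = a x u by have [u] := surj x v; exists u.
by have [u] := free_map_surj surj' w; exists u.
Qed.

(** Q(B, M) is a simple subfunctor of the tensor functor of [M], which is a quotient of [k[B]]. *)
Lemma Qfunctor_subfactor (B : rep C) (M : aut_module k B) n : has_rank B n ->
  simple_module M -> subfactor (klin k B) (Qfunctor M).
Proof.
move=> rB simp; have [[m0 /eqP nz] _] := simp.
apply: (subfactor_surjective (a := lt_mu (lower_tensor M) m0)).
  move=> y v; have /sf_imgP[u _ ->] := simple_mu_surjective simp nz v.
  by exists u.
exists (sf_zero _), (lt_Qsub (lower_tensor M)); split.
  exact: (Qsub_cover C_trivial (ex_intro _ n rB)).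
exact: isomorphic_trans (lt_Qfunctor _) (sub_functor_subquo _).
Qed.

(** Sending [P] to the image of [k[P]] is an order embedding: [v] lies in [P] as soon as [[v]] lies
    in that image. *)
Lemma klin_rank (A : rep C) n : has_rank (klin k A) n -> has_rank A n.
Proof.
apply: (has_rank_embed (psi := fun P : subfunctor A => sf_img (klin_nt k (incl P)) (sf_full _))).
  move=> P Q PQ y v /sf_imgP[u _ ->]; have PQ' z t : t \in P z -> nt_id A z t \in Q z by apply: PQ.
  apply/sf_imgP; exists (klin_nt k (sub_nt PQ') y u); first exact: sf_fullP.
  by rewrite -klin_nt_comp; apply: klin_nt_ext.
move=> P Q le y v vP.
have : << v >> \in sf_img (klin_nt k (incl P)) (sf_full _) y.
  by apply/sf_imgP; exists << (SubModule vP) >>; [apply: sf_fullP | rewrite /= free_mapU].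
move=> /le/sf_imgP[u _ e].
have : coeff v (free_map k (incl Q y) u) != 0.
  by rewrite -[free_map _ _ _]e coeffU eqxx mulr1 oner_eq0.
by case/coeff_free_map_neq0=> [[w wQ] -> _].
Qed.
End LinearizationSeries.

Theorem proposition10p6 (k : fieldType) (C : additive_category)
    (C_small : essentially_small C) (C_trivial : k_trivial k C) (A : rep C) :
  (finite_length A <-> finite_length (klin k A)) /\
  (finite_length A -> forall S : functor C k,
     composition_factor S (klin k A) <->
     exists (B : rep C) (M : aut_module k B),
       [/\ subquotient B A, simple_module M & isomorphic S (Qfunctor M)]).
Proof.
pose PP S := exists (B : rep C) (M : aut_module k B),
  [/\ subquotient B A, simple_module M & isomorphic S (Qfunctor M)].
have PP_iso F G : isomorphic F G -> PP F -> PP G.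
  move=> iso [B [M [sq simp iso']]]; exists B, M; split=> //.
  exact: isomorphic_trans (isomorphic_sym iso) iso'.
have s : finite_length A -> ser PP (sf_zero (klin k A)) (sf_full (klin k A)).
  move=> /finite_length_rank[n rA]; apply: (ser_klin C_trivial PP_iso rA).
  by move=> B M sq simp; exists B, M; split=> //; apply: isomorphic_refl.
split; first split.
- by move/s; apply: ser_finite_length.
- by move/finite_length_rank=> [n /klin_rank]; apply: has_rank_finite_length.
move=> flA S; have [n rA] := finite_length_rank flA.
have flk := ser_finite_length PP_iso (s flA).
apply: (iff_trans (composition_factorP S flk)); split.
  move=> [P [Q [cov iso]]]; apply: (PP_iso _ _ (isomorphic_sym iso)).
  exact: (ser_cover PP_iso (s flA) cov).
move=> [B [M [[P [Q [PQ iso]]] simp isoS]]].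
have rB : has_rank B n := has_rank_iso (isomorphic_sym iso) (has_rank_subquo P Q rA).
(* With [B] isomorphic to [Q / P], the functor [k[Q]] embeds in [k[A]] and surjects onto [k[Q / P]],
   hence onto [k[B]], which has Q(B, M) as a simple factor. *)
have [P1 [Q1 [cov1 iso1]]] : subfactor (klin k A) (Qfunctor M).
  apply: (subfactor_injective (a := klin_nt k (incl Q))).
    by apply: klin_injective => x v v0; apply: val_inj.
  apply: (subfactor_surjective (a := klin_nt k (proj (sub_preim (incl Q) P)))).
    by apply: klin_surjective => x v; exists (qrepr v); rewrite /= qreprK.
  have [b [c [bc cb]]] := isomorphic_sym iso.
  apply: (subfactor_surjective (a := klin_nt k b)).
    by apply: klin_surjective => x v; exists (c x v); apply: cb.
  exact: (Qfunctor_subfactor C_trivial rB simp).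
by exists P1, Q1; split=> //; apply: isomorphic_trans isoS iso1.
Qed.
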